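(* The Reverse algorithm $(\Delta,f_{\mathrm R})$ is ergodic with respect to the $f_{\mathrm R}$-invariant measure $\mu$ on $\Delta$ with density $$h(x_0,x_1,x_2)=\frac{4}{\pi^2(1-x_0)(1-x_1)(1-x_2)}.$$
   Context: Let $\Delta=\{\mathbf x={}^t(x_0,x_1,x_2)\in\mathbb R^3_{>0}: x_0+x_1+x_2=1\}$. Define $\Delta(1)=\{\mathbf x\in\Delta: 2x_0>1\}$, $\Delta(2)=\{\mathbf x\in\Delta: 2x_1>1\}$, $\Delta(3)=\{\mathbf x\in\Delta: 2x_2>1\}$, $\Delta(4)=\{\mathbf x\in\Delta: 2x_i\le 1 \text{ for all } i\in\{0,1,2\}\}$; these four sets partition $\Delta$. The Reverse algorithm is the map $f_{\mathrm R}:\Delta\to\Delta$ (sets of Lebesgue measure zero are ignored) given by $$f_{\mathrm R}(\mathbf x)=\begin{cases}{}^t\big(\frac{x_0-x_1-x_2}{x_0},\frac{x_1}{x_0},\frac{x_2}{x_0}\big)&\mathbf x\in\Delta(1),\\ {}^t\big(\frac{x_0}{x_1},\frac{-x_0+x_1-x_2}{x_1},\frac{x_2}{x_1}\big)&\mathbf x\in\Delta(2),\\ {}^t\big(\frac{x_0}{x_2},\frac{x_1}{x_2},\frac{-x_0-x_1+x_2}{x_2}\big)&\mathbf x\in\Delta(3),\\ {}^t\big(-x_0+x_1+x_2,\;x_0-x_1+x_2,\;x_0+x_1-x_2\big)&\mathbf x\in\Delta(4).\end{cases}$$ The density $h$ is taken with respect to two-dimensional Lebesgue measure on $\Delta$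 (e.g. $dx_0\,dx_1$ in the coordinates $(x_0,x_1)$); it is known that $\mu$ is an $f_{\mathrm R}$-invariant probability measure. *)

(* Defs.v *)
From HB Require Import structures.
From mathcomp Require Import all_boot all_order all_algebra.
From mathcomp Require Import all_classical all_reals all_analysis.
From mathcomp Require Import measurable_realfun lra.

Set Implicit Arguments.
Unset Strict Implicit.
Unset Printing Implicit Defensive.

Import Order.TTheory GRing.Theory Num.Theory.
Import numFieldNormedType.Exports.

Local Open Scope classical_set_scope.
Local Open Scope ring_scope.

Section ergodicity.
Context d (T : measurableType d) (R : realType).
Implicit Types (mu : {measure set T -> \bar R}) (f : T -> T).

Definition measure_preserving mu f : Prop :=
  measurable_fun setT f /\
  forall A, measurable A -> mu (f @^-1` A) = mu A.

(* Only meant for a probability measure preserved by f. Invariance of A is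
   required modulo mu, so that f may be changed on a null set. *)
Definition ergodic mu f : Prop :=
  forall A, measurable A -> mu ((f @^-1` A) `+` A) = 0%E ->
    mu A = 0%E \/ mu A = 1%E.

End ergodicity.

Section reverse_algorithm.
Context {R : realType}.

(* The point (x0, x1, x2) of R^3 is ((x0, x1), x2) : R * R * R. *)

Definition Delta : set (R * R * R) :=
  [set x | let: (x0, x1, x2) := x in
    [/\ 0 < x0, 0 < x1, 0 < x2 & x0 + x1 + x2 = 1]].

Definition Delta1 : set (R * R * R) :=
  Delta `&` [set x | let: (x0, x1, x2) := x in 1 < 2 * x0].

Definition Delta2 : set (R * R * R) :=
  Delta `&` [set x | let: (x0, x1, x2) := x in 1 < 2 * x1].

Definition Delta3 : set (R * R * R) :=
  Delta `&` [set x | let: (x0, x1, x2) := x in 1 < 2 * x2].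

Definition Delta4 : set (R * R * R) :=
  Delta `&` [set x | let: (x0, x1, x2) := x in
    [/\ 2 * x0 <= 1, 2 * x1 <= 1 & 2 * x2 <= 1]].

(* Only the values on Delta matter: the identity outside Delta is a dummy
   value. A point of Delta4 with some 2 * x_i = 1 is sent to the boundary of
   the simplex, outside Delta; these points form a null set. *)
Definition f_R (x : R * R * R) : R * R * R :=
  let: (x0, x1, x2) := x in
  if x \in Delta1 then ((x0 - x1 - x2) / x0, x1 / x0, x2 / x0)
  else if x \in Delta2 then (x0 / x1, (- x0 + x1 - x2) / x1, x2 / x1)
  else if x \in Delta3 then (x0 / x2, x1 / x2, (- x0 - x1 + x2) / x2)
  else if x \in Delta4 then (- x0 + x1 + x2, x0 - x1 + x2, x0 + x1 - x2)
  else x.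

Definition h (x : R * R * R) : R :=
  let: (x0, x1, x2) := x in
  4 / (pi ^+ 2 * (1 - x0) * (1 - x1) * (1 - x2)).

Definition plane_point (z : R * R) : R * R * R := (z.1, z.2, 1 - z.1 - z.2).

(* The measure on R^3 carried by Delta, with density h with respect to
   dx0 dx1 in the coordinates (x0, x1) of the plane x0 + x1 + x2 = 1. *)
Definition mu (A : set (R * R * R)) : \bar R :=
  (\int[lebesgue_measure \x lebesgue_measure]_(z in
     plane_point @^-1` (Delta `&` A)) (h (plane_point z))%:E)%E.

Lemma measurable_plane_point : measurable_fun setT plane_point.
Proof.
apply: measurable_fun_pair; first exact: measurable_fun_pair.
by apply: measurable_funB => //; apply: measurable_funB.
Qed.

Lemma measurable_Delta : measurable Delta.
Proof.
pose g (x : R * R * R) :=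
  [&& 0 < x.1.1, 0 < x.1.2, 0 < x.2 & x.1.1 + x.1.2 + x.2 == 1].
have mg : measurable_fun setT g.
  apply: measurable_and; first exact: measurable_fun_ltr (measurableT_comp _ _).
  apply: measurable_and; first exact: measurable_fun_ltr (measurableT_comp _ _).
  apply: measurable_and; first exact: measurable_fun_ltr.
  apply: measurable_fun_eqr => //; apply: measurable_funD => //.
  by apply: measurable_funD; exact: measurableT_comp.
rewrite (_ : Delta = g @^-1` [set true]); first by rewrite -[X in measurable X]setTI; exact: mg.
apply/seteqP; split => -[[a b] c] /=.
  by move=> [a0 b0 c0 /eqP abc]; apply/and4P.
by move=> /and4P[a0 b0 c0 /eqP].
Qed.

Lemma measurable_invr : measurable_fun [set: R] (@GRing.inv R).
Proof.
rewrite -(setvU [set 0 : R]); apply/measurable_funU => //.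
  exact: measurableC.
split; last exact: measurable_fun_set1.
apply: open_continuous_measurable_fun.
  by apply: closed_openC; exact: closed_eq.
by move=> x; rewrite inE => /eqP x0; exact: inv_continuous.
Qed.

Lemma measurable_h : measurable_fun setT h.
Proof.
rewrite (_ : h = fun x : R * R * R =>
    4 * (pi ^+ 2 * (1 - x.1.1) * (1 - x.1.2) * (1 - x.2))^-1); last first.
  by apply/funext => -[[a b] c].
apply: measurable_funM => //.
apply: (measurableT_comp measurable_invr).
apply: measurable_funM; last exact: measurable_funB.
apply: measurable_funM; last by apply: measurable_funB => //; exact: measurableT_comp.
apply: measurable_funM => //.
by apply: measurable_funB => //; exact: measurableT_comp.
Qed.

Lemma h_ge0 x : Delta x -> 0 <= h x.
Proof.
case: x => -[a b] c [a0 b0 c0 abc] /=.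
by rewrite divr_ge0// !mulr_ge0 ?pi_ge0//; lra.
Qed.

Let mu_set0 : mu set0 = 0%E.
Proof. by rewrite /mu setI0 preimage_set0 integral_set0. Qed.

Let mu_ge0 A : (0 <= mu A)%E.
Proof. by apply: integral_ge0 => z [Dz _]; rewrite lee_fin h_ge0. Qed.

Let mu_semi_sigma_additive : semi_sigma_additive mu.
Proof.
move=> F mF tF mUF; rewrite /mu setI_bigcupr preimage_bigcup.
have mDF n : measurable (plane_point @^-1` (Delta `&` F n)).
  rewrite -[X in measurable X]setTI; apply: measurable_plane_point => //.
  by apply: measurableI => //; exact: measurable_Delta.
rewrite ge0_integral_bigcup//.
- apply: is_cvg_ereal_nneg_natsum_cond => n _ _.
  by apply: integral_ge0 => z [Dz _]; rewrite lee_fin h_ge0.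
- apply/measurable_EFinP; apply: measurable_funTS.
  exact: measurableT_comp measurable_h measurable_plane_point.
- by move=> z [n _ [Dz _]]; rewrite lee_fin h_ge0.
- apply/trivIsetP => i j _ _ ij; rewrite -preimage_setI setIACA setIid.
  by move/trivIsetP : tF => /(_ _ _ I I ij) ->; rewrite setI0 preimage_set0.
Qed.

HB.instance Definition _ := isMeasure.Build _ _ _ mu
  mu_set0 mu_ge0 mu_semi_sigma_additive.

End reverse_algorithm.

(* Main.v *)
Require Import Defs.
From mathcomp Require Import all_boot all_order all_algebra.
From mathcomp Require Import all_classical all_reals all_analysis.
From mathcomp Require Import measurable_realfun ring lra.

Set Implicit Arguments.
Unset Strict Implicit.
Unset Printing Implicit Defensive.

Import Order.TTheory GRing.Theory Num.Theory.
Import numFieldNormedType.Exports.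

Local Open Scope classical_set_scope.
Local Open Scope ring_scope.

(** The four inverse branches of [f_R] are projective maps given by nonnegative
matrices, and each branch of [f_R] is onto [Delta].  Integrals of functions
homogeneous of degree -3 pull back along them without Jacobian, up to the
constant factor [|det|]; invariance of [mu] is then a rational identity, and
the total mass reduces, by two applications of Tonelli's theorem, to
the integral of [2 atan t / (1 + t^2)] on the half-line.

Ergodicity.  The square of the matrix of the central branch (the one defined on
[Delta4]) is [y |-> y + |y| (1, 1, 1)].  Hence the cylinders whose word ends
with two central letters have distortion bounded by a universal constant, and
each occurrence of two central letters divides the extent of the cylinder by
two.  Almost every orbit visits the double central branch infinitely often:
the set [B] of points avoiding a branch satisfies [B <= f^-1 B], so the part of
[f^-1 B] lying in the branch is null because [mu] is finite, and it is mapped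
onto [B].  Therefore cylinders generate the sigma-algebra up to null sets, and
an invariant set of positive measure occupies a fixed proportion of
every cylinder ending with two central letters, so its complement is null. *)

Ltac ord4 i := case: i => -[|[|[|[|//]]]] ?.

(** * Substitutions in Lebesgue integrals *)

Section substitution.
Context {R : realType}.
Local Notation leb := (@lebesgue_measure R).
Local Open Scope ereal_scope.
Implicit Type f : R -> \bar R.

Lemma measurable_affine (a b : R) :
  measurable_fun setT (fun x : measurableTypeR R => (a * x + b)%R : measurableTypeR R).
Proof. by apply: measurable_funD => //; apply: measurable_funM. Qed.

(** By uniqueness of Lebesgue measure: [|a|] times the pushforward agrees with it on half-open
    intervals. A negative [a] reverses the interval and exchanges its open and closed ends. *)
Lemma lebesgue_measure_affine (a b : R) (A : set (measurableTypeR R)) :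
  (a != 0)%R -> measurable A ->
  leb A = `|a|%:E * leb ((fun x : R => a * x + b)%R @^-1` A).
Proof.
move=> a0 mA.
have mf := measurable_affine a b.
pose m : {measure set (measurableTypeR R) -> \bar R} := mscale (NngNum (normr_ge0 a))
  (measure_function_pushforward__canonical__measure_function_Measure leb mf).
apply: (@lebesgue_measure_unique R m) => // _ [[c d]] _ <-.
rewrite /m /mscale/= /mscale/= /pushforward.
have [a_gt0|a_lt0] := ltP 0%R a.
  rewrite (_ : _ @^-1` _ = `](c - b) / a, (d - b) / a]%classic)%R; last first.
    by apply/seteqP; split=> x /=; rewrite !in_itv/= ltr_pdivrMr// ler_pdivlMr//
      ltrBlDr lerBrDr ![(x * a)%R]mulrC.
  rewrite !lebesgue_measure_itv/= !lte_fin ltr_pM2r ?invr_gt0// ltrD2r.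
  case: ifPn => _; last by rewrite mule0.
  rewrite -!EFinB -EFinM gtr0_norm//; congr EFin; field; exact: a0.
have {}a_lt0 : (a < 0)%R by rewrite lt_neqAle a0.
rewrite (_ : _ @^-1` _ = `[(d - b) / a, (c - b) / a[%classic)%R; last first.
  by apply/seteqP; split=> x /=; rewrite !in_itv/= ltr_ndivlMr// ler_ndivrMr//
      ltrBlDr lerBrDr ![(x * a)%R]mulrC andbC.
rewrite !lebesgue_measure_itv/= !lte_fin ltr_nM2r ?invr_lt0// ltrD2r.
case: ifPn => _; last by rewrite mule0.
rewrite -!EFinB -EFinM ltr0_norm//; congr EFin; field; exact: a0.
Qed.

Lemma ge0_integral_affine (a b : R) f : (a != 0)%R ->
  measurable_fun setT f -> (forall x, 0 <= f x) ->
  \int[leb]_x f x = `|a|%:E * \int[leb]_x f (a * x + b)%R.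
Proof.
move=> a0 mf f0; have maff := measurable_affine a b.
have := @ge0_integral_pushforward _ _ _ _ R _ maff leb setT f measurableT mf (fun x _ => f0 x).
rewrite preimage_setT => <-.
rewrite -(ge0_integral_mscale
  (measure_function_pushforward__canonical__measure_function_Measure leb maff) measurableT (NngNum (normr_ge0 a)) mf)//.
apply: eq_measure_integral => A mA _.
exact: lebesgue_measure_affine.
Qed.

Lemma ge0_integral_scale (a : R) f : (0 < a)%R ->
  measurable_fun setT f -> (forall x, 0 <= f x) ->
  \int[leb]_x f x = a%:E * \int[leb]_x f (a * x)%R.
Proof.
move=> a0 mf f0; rewrite (@ge0_integral_affine a 0) ?gt_eqF// gtr0_norm//.
by under eq_integral do rewrite addr0.
Qed.

(** The substitution [x = 1 / u], obtained from Tonelli and scalings alone. With [I] the indicator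
    of []0, 1[], [f x] is the integral over [y] of [x * f x * I (x * y)]. Replacing [x] by [x / y],
    exchanging the integrals and replacing [y] by [x * u] separates the variables, and [I]
    integrates to 1. *)
Lemma ge0_integral_inv f : measurable_fun setT f -> (forall x, 0 <= f x) ->
  (forall x, (x <= 0)%R -> f x = 0) ->
  \int[leb]_x f x = \int[leb]_x ((x^-1 ^+ 2)%R%:E * f (x^-1)%R).
Proof.
move=> mf f0 fN.
have minv := @measurable_invr R.
pose I := fun x : R => (\1_(`]0%R, 1%R[%classic : set R) x)%R : R.
have mI : measurable_fun setT I by exact: measurable_indic.
have I0 x : (0 <= I x)%R by rewrite /I.
have fx0 x : 0 <= x%:E * f x.
  by have [x0|/ltW x0] := leP x 0%R; [rewrite fN// mule0|rewrite mule_ge0].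
pose F (z : R * R) := z.1%:E * f z.1 * (I (z.1 * z.2)%R)%:E.
pose G (z : R * R) := z.1^-1%R%:E * ((z.2 * z.1^-1)%R%:E * f (z.2 * z.1^-1)%R * (I z.2)%:E).
have mF : measurable_fun setT F.
  apply: emeasurable_funM.
    apply: emeasurable_funM; first exact/measurable_EFinP.
    exact: measurableT_comp.
  by apply/measurable_EFinP; apply: measurableT_comp => //; apply: measurable_funM.
have mq : measurable_fun setT (fun z : R * R => z.2 * z.1^-1)%R.
  by apply: measurable_funM => //; exact: measurableT_comp.
have mGy : measurable_fun setT
    (fun z : R * R => (z.2 * z.1^-1)%R%:E * f (z.2 * z.1^-1)%R * (I z.2)%:E).
  apply: emeasurable_funM; last by apply/measurable_EFinP; exact: measurableT_comp.
  by apply: emeasurable_funM; [exact/measurable_EFinP|exact: measurableT_comp].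
have mG : measurable_fun setT G.
  apply: emeasurable_funM; last exact: mGy.
  by apply/measurable_EFinP; exact: measurableT_comp.
have G1 z : 0 <= (z.2 * z.1^-1)%R%:E * f (z.2 * z.1^-1)%R * (I z.2)%:E.
  by apply: mule_ge0; [exact: fx0|rewrite lee_fin].
have F0 z : 0 <= F z by rewrite mule_ge0// lee_fin.
have G0 z : 0 <= G z.
  rewrite /G; have [z0|z0] := leP 0%R z.1; first by apply: mule_ge0;
    [rewrite lee_fin invr_ge0|apply: mule_ge0; [exact: fx0|rewrite lee_fin]].
  rewrite /I indicE mem_setE/= in_itv/=.
  have [/andP[z20 _]|] := boolP (_ < z.2 < _)%R; last by rewrite !mule0.
  by rewrite (fN (z.2 / z.1)%R) ?mule0 ?mul0e ?mule0// pmulr_rle0// invr_le0 ltW.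
transitivity (\int[leb]_x \int[leb]_y F (x, y)).
  apply: eq_integral => x _; rewrite /F/=.
  rewrite ge0_integralZl//; last 2 first.
  - by apply/measurable_EFinP; apply: measurableT_comp => //; exact: measurable_funM.
  - by move=> ? _; rewrite lee_fin.
  have [x0|x0] := leP x 0%R; first by rewrite fN// mule0 mul0e.
  rewrite (_ : integral _ _ _ = x^-1%R%:E); last first.
    under eq_integral => y _.
      rewrite /I indicE mem_setE/= in_itv/= -ltr_pdivrMl// mulr0.
      rewrite -[X in _ && X]ltr_pdivlMl// mulr1.
      over.
    rewrite (_ : (fun _ => _) = fun y => (\1_(`]0%R, x^-1[%classic : set R) y)%:E); last first.
      by apply/funext => y; rewrite indicE mem_setE/= in_itv.
    rewrite integral_indic// setIT/= lebesgue_measure_itv/= lte_fin invr_gt0 x0.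
    by rewrite oppr0 adde0.
  rewrite muleAC -EFinM mulfV ?gt_eqF// mul1e//.
rewrite (@fubini_tonelli _ _ _ _ R leb leb F mF F0).
transitivity (\int[leb]_y \int[leb]_x G (y, x)).
  apply: eq_integral => y _.
  have [y0|y0] := leP y 0%R.
    rewrite !integral0_eq// => x _; rewrite /G /F /=.
      rewrite /I indicE mem_setE/= in_itv/=.
      have [/andP[x0 _]|] := boolP (_ < x < _)%R; last by rewrite !mule0.
      by rewrite (fN (x / y)%R) ?mule0 ?mul0e ?mule0// pmulr_rle0// invr_le0.
    have [x0|x0] := leP x 0%R; first by rewrite fN// mule0 mul0e.
    by rewrite /I indicE mem_setE/= in_itv/= pmulr_rgt0// ltNge y0 mule0.
  rewrite (@ge0_integral_scale y^-1 (fun x => F (x, y))) ?invr_gt0//; last first.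
    exact: measurableT_comp.
  rewrite /G /= ge0_integralZl//; last 3 first.
  - exact: (measurableT_comp mGy (pair1_measurable y)).
  - by move=> x _; exact: G1 (y, x).
  - by rewrite lee_fin invr_ge0 ltW.
  congr *%E; apply: eq_integral => x _; rewrite /F/= mulrC.
  by rewrite -(mulrA x) mulVf ?gt_eqF// mulr1.
rewrite (@fubini_tonelli _ _ _ _ R leb leb G mG G0).
transitivity (\int[leb]_x ((I x)%:E * \int[leb]_x ((x^-1 ^+ 2)%R%:E * f (x^-1)%R))).
  apply: eq_integral => x _.
  have [/andP[x0 x1]|/negbTE x01] := boolP (0 < x < 1)%R; last first.
    rewrite [I x]indicE mem_setE/= in_itv/= x01 mul0e integral0_eq// => y _.
    by rewrite /G/= [I x]indicE mem_setE/= in_itv/= x01 !mule0.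
  rewrite (@ge0_integral_scale x (fun y => G (y, x)))//; last exact: measurableT_comp.
  rewrite [I x]indicE mem_setE/= in_itv/= x0 x1 mul1e.
  rewrite -ge0_integralZl//; last 2 first.
  - have mx : measurable_fun setT (fun u : R => x * u)%R by exact: measurable_funM.
    exact: (measurableT_comp (measurableT_comp mG (pair2_measurable x)) mx).
  - by rewrite lee_fin ltW.
  apply: eq_integral => u _.
  rewrite /G/= [I x]indicE mem_setE/= in_itv/= x0 x1 mule1 invfM mulrA mulfV ?gt_eqF// mul1r.
  by rewrite !muleA -!EFinM (mulrA x) mulfV ?gt_eqF// mul1r.
rewrite ge0_integralZr//.
- by rewrite /I integral_indic// setIT/= lebesgue_measure_itv/= lte_fin ltr01 oppr0 adde0 mul1e.
- exact/measurable_EFinP.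
- by move=> ? _; rewrite lee_fin.
- by apply: integral_ge0 => u _; rewrite mule_ge0// lee_fin sqr_ge0.
Qed.

End substitution.

(** * Integration over the plane of the simplex *)

Section plane.
Context {R : realType}.
Local Notation leb := (@lebesgue_measure R).
Local Notation pt := (R * R * R)%type.
Local Open Scope ereal_scope.
Implicit Types (Phi : pt -> \bar R) (x y : pt).

(** The integral runs over the whole plane; a domain enters by extending the integrand by zero. *)
Definition plane_integral Phi : \bar R :=
  \int[leb \x leb]_z Phi (plane_point z).

Definition swap01 x : pt := let: (a, b, c) := x in (b, a, c).
Definition swap12 x : pt := let: (a, b, c) := x in (a, c, b).

Lemma measurable_swap01 : measurable_fun setT swap01.
Proof.
rewrite (_ : swap01 = fun x => (x.1.2, x.1.1, x.2)); last by apply/funext => -[[]].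
by apply: measurable_fun_pair => //; apply: measurable_fun_pair; exact: measurableT_comp.
Qed.

Lemma measurable_swap12 : measurable_fun setT swap12.
Proof.
rewrite (_ : swap12 = fun x => (x.1.1, x.2, x.1.2)); last by apply/funext => -[[]].
apply: measurable_fun_pair; last exact: measurableT_comp.
by apply: measurable_fun_pair => //; exact: measurableT_comp.
Qed.

Section fubini.
Variable Phi : pt -> \bar R.
Hypothesis mPhi : measurable_fun setT Phi.
Hypothesis Phi0 : forall x, 0 <= Phi x.

Lemma measurable_plane : measurable_fun setT (Phi \o plane_point).
Proof. exact: measurableT_comp mPhi measurable_plane_point. Qed.

Lemma plane_integralE :
  plane_integral Phi = \int[leb]_a \int[leb]_b Phi (plane_point (a, b)).
Proof.
exact: (@fubini_tonelli1 _ _ _ _ R leb leb _ measurable_plane (fun=> Phi0 _)).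
Qed.

Lemma measurable_line (a : R) :
  measurable_fun setT (fun b => Phi (plane_point (a, b))).
Proof. exact: (measurableT_comp measurable_plane (pair1_measurable a)). Qed.

Lemma plane_integral_swap01 : plane_integral Phi = plane_integral (Phi \o swap01).
Proof.
rewrite plane_integralE.
rewrite (@fubini_tonelli _ _ _ _ R leb leb _ measurable_plane (fun=> Phi0 _)).
rewrite /plane_integral.
have m01 := measurableT_comp (measurableT_comp mPhi measurable_swap01) measurable_plane_point.
rewrite (@fubini_tonelli1 _ _ _ _ R leb leb _ m01 (fun=> Phi0 _)).
apply: eq_integral => a _; apply: eq_integral => b _.
by rewrite /= /plane_point/= addrAC.
Qed.

(** With [x0 = a] fixed, exchanging [x1] and [x2] is the reflection of [b] into [1 - a - b], which
    preserves length. *)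
Lemma plane_integral_swap12 : plane_integral Phi = plane_integral (Phi \o swap12).
Proof.
rewrite plane_integralE.
have m12 := measurableT_comp (measurableT_comp mPhi measurable_swap12) measurable_plane_point.
rewrite /plane_integral (@fubini_tonelli1 _ _ _ _ R leb leb _ m12 (fun=> Phi0 _)).
apply: eq_integral => a _.
rewrite (@ge0_integral_affine _ (-1) (1 - a))//; last exact: measurable_line.
rewrite normrN1 mul1e; apply: eq_integral => b _.
by rewrite /= /plane_point/=; congr (Phi (_, _, _)); ring.
Qed.

(** On the plane this is the homothety of ratio [-1/2] about the barycentre, inverse to the formula
    of [f_R] on [Delta4]; it divides areas by 4. *)
Lemma plane_integral_center : plane_integral Phi =
  plane_integral (fun x => (4^-1)%R%:E *
    Phi ((1 - x.1.1) / 2, (1 - x.1.2) / 2, (1 - x.2) / 2)%R).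
Proof.
rewrite plane_integralE; pose F (a : R) := \int[leb]_b Phi (plane_point (a, b)).
rewrite -[LHS]/(\int[leb]_a F a).
have mF : measurable_fun setT F.
  exact: (@measurable_fun_fubini_tonelli_F _ _ _ _ _ leb _ measurable_plane (fun=> Phi0 _)).
have F0 a : 0 <= F a by apply: integral_ge0.
rewrite (@ge0_integral_affine _ (- 2^-1) 2^-1 F) ?oppr_eq0 ?invr_eq0//.
rewrite normrN ger0_norm ?invr_ge0//.
pose c x : pt := ((1 - x.1.1) / 2, (1 - x.1.2) / 2, (1 - x.2) / 2)%R.
have mc : measurable_fun setT c.
  by apply: measurable_fun_pair; [apply: measurable_fun_pair|];
    apply: measurable_funM => //; apply: measurable_funB => //; exact: measurableT_comp.
have mPc := measurableT_comp (measurableT_comp mPhi mc) measurable_plane_point.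
rewrite /plane_integral ge0_integralZl//.
rewrite (@fubini_tonelli1 _ _ _ _ R leb leb _ mPc (fun=> Phi0 _)).
rewrite (_ : 4^-1%R = (2^-1 * 2^-1)%R); last by rewrite -invfM -natrM.
rewrite EFinM -muleA; congr *%E.
rewrite -ge0_integralZl//; last 2 first.
- exact: (@measurable_fun_fubini_tonelli_F _ _ _ _ _ leb _ mPc (fun=> Phi0 _)).
- by move=> a _; apply: integral_ge0 => *; exact: Phi0.
apply: eq_integral => a _.
rewrite /F (@ge0_integral_affine _ (- 2^-1) 2^-1) ?oppr_eq0 ?invr_eq0//; last exact: measurable_line.
rewrite normrN ger0_norm ?invr_ge0//; congr *%E; apply: eq_integral => b _ /=.
by rewrite /c /plane_point/=; congr (Phi (_, _, _)); field.
Qed.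

(** Pullback along the inverse of the branch of [f_R] on [Delta1], written on the plane
    [x0 + x1 + x2 = 1]; the cube is the Jacobian. *)
Definition vertex_pull x : \bar R := ((2 - x.1.1)^-1 ^+ 3)%R%:E *
  Phi ((2 - x.1.1)^-1, x.1.2 / (2 - x.1.1), x.2 / (2 - x.1.1))%R.

Lemma measurable_vertex_pull : measurable_fun setT vertex_pull.
Proof.
have m2 : measurable_fun setT (fun x : pt => (2 - x.1.1)^-1)%R.
  apply: (measurableT_comp (@measurable_invr R)); apply: measurable_funB => //.
  exact: measurableT_comp.
apply: emeasurable_funM; first by apply/measurable_EFinP; exact: measurable_funX.
apply: (measurableT_comp mPhi).
apply: measurable_fun_pair; last by apply: measurable_funM.
apply: measurable_fun_pair => //; apply: measurable_funM => //.
exact: measurableT_comp.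
Qed.

Hypothesis PhiN : forall x, (x.1.1 <= 0)%R -> Phi x = 0.

Lemma vertex_pull_eq0 x : (2 <= x.1.1)%R -> vertex_pull x = 0.
(* The case [x.1.1 = 2] is included thanks to the convention [0^-1 = 0]. *)
Proof. by move=> x2; rewrite /vertex_pull PhiN ?mule0//= invr_le0 subr_le0. Qed.

Lemma vertex_pull_ge0 x : 0 <= vertex_pull x.
Proof.
have [/vertex_pull_eq0->//|x2] := leP 2%R x.1.1.
by rewrite mule_ge0// lee_fin exprn_ge0// invr_ge0 subr_ge0 ltW.
Qed.

(** The substitution by [1 / (2 - a)] in the outer variable contributes the square of this number,
    and scaling the inner variable by it contributes the third factor. *)
Lemma plane_integral_vertex : plane_integral Phi = plane_integral vertex_pull.
Proof.
rewrite plane_integralE; pose F (a : R) := \int[leb]_b Phi (plane_point (a, b)).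
rewrite -[LHS]/(\int[leb]_a F a).
have mF : measurable_fun setT F.
  exact: (@measurable_fun_fubini_tonelli_F _ _ _ _ _ leb _ measurable_plane (fun=> Phi0 _)).
have F0 a : 0 <= F a by apply: integral_ge0.
have FN a : (a <= 0)%R -> F a = 0.
  by move=> a0; rewrite /F integral0_eq// => b _; exact: PhiN.
have minv := @measurable_invr R.
rewrite (ge0_integral_inv mF F0 FN).
rewrite (@ge0_integral_affine _ (-1) 2 (fun u => (u^-1 ^+ 2)%R%:E * F (u^-1)%R)) ?oppr_eq0//; last 2 first.
- apply: emeasurable_funM; last exact: measurableT_comp.
  by apply/measurable_EFinP; apply: measurable_funX; exact: measurableT_comp.
- by move=> u; rewrite mule_ge0// lee_fin sqr_ge0.
rewrite normrN1 mul1e /plane_integral.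
have mPp := measurableT_comp measurable_vertex_pull measurable_plane_point.
rewrite (@fubini_tonelli1 _ _ _ _ R leb leb _ mPp (fun=> vertex_pull_ge0 _)).
apply: eq_integral => a _; rewrite /fubini_F mulN1r addrC.
have [a2|a2] := leP 2%R a.
  rewrite FN ?invr_le0 ?subr_le0// mule0 integral0_eq// => b _.
  exact: vertex_pull_eq0.
rewrite -subr_gt0 in a2.
rewrite /F (@ge0_integral_scale _ (2 - a)^-1)//; last 2 first.
- by rewrite invr_gt0.
- exact: measurable_line.
rewrite muleA -EFinM -exprSr -ge0_integralZl//; last 2 first.
- have mx : measurable_fun setT (fun u : R => (2 - a)^-1 * u)%R by exact: measurable_funM.
  exact: (measurableT_comp (measurable_line _) mx).
- by rewrite lee_fin exprn_ge0// invr_ge0 ltW.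
apply: eq_integral => b _; rewrite /vertex_pull /plane_point /=; congr (_ * Phi (_, _, _)).
  by rewrite mulrC.
by field; rewrite gt_eqF.
Qed.

End fubini.
End plane.

(** * The branches as projective maps *)

Section cone.
Context {R : realType}.
Local Notation pt := (R * R * R)%type.
Implicit Types (x y : pt) (i : 'I_4) (w : seq 'I_4).

Definition csum x : R := x.1.1 + x.1.2 + x.2.

Definition scale (t : R) x : pt := (t * x.1.1, t * x.1.2, t * x.2).

Definition cone : set pt := [set x | [/\ 0 < x.1.1, 0 < x.1.2 & 0 < x.2]].

Definition branch i : set pt :=
  match val i with 0%N => Delta1 | 1%N => Delta2 | 2%N => Delta3 | _ => Delta4 end.

Definition cone_map i x : pt := let: (a, b, c) := x in
  match val i with
  | 0%N => (a + b + c, b, c) | 1%N => (a, a + b + c, c) | 2%N => (a, b, a + b + c)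
  | _ => (b + c, a + c, a + b)
  end.

(** The absolute value of the determinant of [cone_map i]. *)
Definition cone_det i : R := if val i == 3%N then 2 else 1.

Definition inv_branch i x : pt := scale (csum (cone_map i x))^-1 (cone_map i x).

Lemma DeltaE x : Delta x <-> cone x /\ csum x = 1.
Proof.
by case: x => -[a b] c; split => [[a0 b0 c0 abc]|[[a0 b0 c0] abc]]; do ?split.
Qed.

Lemma cone_map_cone i x : cone x -> cone (cone_map i x).
Proof. by ord4 i; case: x => -[a b] c [/= *]; split => /=; lra. Qed.

Lemma csum_gt0 x : cone x -> 0 < csum x.
Proof. by case: x => -[a b] c [/= *]; rewrite /csum/=; lra. Qed.

Lemma scale_cone t x : 0 < t -> cone x -> cone (scale t x).
Proof. by move=> t0; case: x => -[a b] c [/= *]; split; rewrite /= mulr_gt0. Qed.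

Lemma csum_scale t x : csum (scale t x) = t * csum x.
Proof. by rewrite /csum /=; ring. Qed.

Lemma inv_branch_Delta i x : cone x -> Delta (inv_branch i x).
Proof.
move=> x0; have Mx := cone_map_cone i x0; have tx := csum_gt0 Mx.
apply/DeltaE; split; first by apply: scale_cone; rewrite ?invr_gt0.
by rewrite csum_scale mulVf// gt_eqF.
Qed.

Lemma branch_Delta i x : branch i x -> Delta x.
Proof. by ord4 i => -[]. Qed.

Lemma branchP x : Delta x -> exists i, branch i x.
Proof.
move=> Dx; case: x Dx => -[a b] c Dx.
have [a1|a1] := ltP 1 (2 * a); first by exists (inord 0); rewrite /branch /= inordK.
have [b1|b1] := ltP 1 (2 * b); first by exists (inord 1); rewrite /branch /= inordK.
have [c1|c1] := ltP 1 (2 * c); first by exists (inord 2); rewrite /branch /= inordK.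
by exists (inord 3); rewrite /branch /= inordK.
Qed.

Lemma branch_inj i j x : branch i x -> branch j x -> i = j.
Proof.
move=> Di Dj; apply: val_inj; move: Di Dj; rewrite /branch.
case: x => -[a b] c; ord4 i; ord4 j => //= -[/= [a0 b0 c0 abc]] + [_] => p /= q; exfalso.
all: do ?match goal with H : and3 _ _ _ |- _ => case: H => ? ? ? end; lra.
Qed.

Lemma f_R_branch i x : branch i x -> f_R x =
  let: (a, b, c) := x in
  match val i with
  | 0%N => ((a - b - c) / a, b / a, c / a) | 1%N => (a / b, (- a + b - c) / b, c / b)
  | 2%N => (a / c, b / c, (- a - b + c) / c)
  | _ => (- a + b + c, a - b + c, a + b - c)
  end.
Proof.
move=> Dx; have D j : x \in branch j = (j == i).
  apply/idP/eqP => [|->]; last by rewrite inE.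
  by rewrite inE => /branch_inj; exact.
have /= := D (inord 0); rewrite /branch /= inordK//= => D0.
have /= := D (inord 1); rewrite /branch /= inordK//= => D1.
have /= := D (inord 2); rewrite /branch /= inordK//= => D2.
have /= := D (inord 3); rewrite /branch /= inordK//= => D3.
case: x {Dx D} D0 D1 D2 D3 => -[a b] c D0 D1 D2 D3.
rewrite /f_R D0 D1 D2 D3 -!val_eqE/= !inordK//.
by clear; ord4 i.
Qed.

Lemma inv_branch_branch i x : Delta x -> branch i (inv_branch i x).
Proof.
move=> Dx; have [cx _] := (DeltaE x).1 Dx.
have t0 := csum_gt0 (cone_map_cone i cx).
(* The inverse of the sum is abstracted into a positive [u] known only by its defining equation,
   which leaves polynomial inequalities. *)
have := mulfV (lt0r_neq0 t0); have := inv_branch_Delta i cx.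
have : 0 < (csum (cone_map i x))^-1 by rewrite invr_gt0.
rewrite /inv_branch; move: (_ ^-1) => u u0 Dix tu.
move: Dix tu {t0}; rewrite /branch /csum /cone_map /scale.
ord4 i; case: x Dx {cx} => -[a b] c [a0 b0 c0 abc] /= Dix tu; (split => //=);
  rewrite ?abc in tu *; [nra..|split; nra].
Qed.

(** Only membership in the plane is asked of [x], because [density_integral_branch] applies this
    before knowing that [x] lies in [Delta]. *)
Lemma f_R_inv_branch i x : csum x = 1 ->
  branch i (inv_branch i x) -> f_R (inv_branch i x) = x.
Proof.
move=> tx Bx; rewrite (f_R_branch Bx).
(* If the sum were zero, [0^-1 = 0] would send [x] to the origin, which is outside [Delta]. *)
have t0 : csum (cone_map i x) != 0.
  have [[+ _ _] _] := (DeltaE _).1 (branch_Delta Bx).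
  apply: contraTneq => tx0; rewrite /inv_branch /scale tx0 invr0/= mul0r ltxx//.
move: t0 {Bx}; rewrite /inv_branch /scale /cone_map; move: tx.
ord4 i; case: x => -[a b] c; rewrite /csum /= => abc; rewrite ?abc => t0;
  congr (_, _, _); try by field.
- by rewrite (_ : a = 1 - b - c); [field|lra].
- by rewrite (_ : b = 1 - a - c); [field|lra].
- by rewrite (_ : c = 1 - a - b); [field|lra].
- by rewrite (_ : b + c + (a + c) + (a + b) = 2); lra.
- by rewrite (_ : b + c + (a + c) + (a + b) = 2); lra.
- by rewrite (_ : b + c + (a + c) + (a + b) = 2); lra.
Qed.

Lemma measurable_csum : measurable_fun setT (csum : pt -> R).
Proof.
by apply: measurable_funD => //; apply: measurable_funD; exact: measurableT_comp.
Qed.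

Lemma measurable_fst_fst : measurable_fun setT (fun x : pt => x.1.1).
Proof. exact: measurableT_comp. Qed.

Lemma measurable_fst_snd : measurable_fun setT (fun x : pt => x.1.2).
Proof. exact: measurableT_comp. Qed.

Hint Resolve measurable_fst_fst measurable_fst_snd : core.

Lemma measurable_triple (u v w : pt -> R) : measurable_fun setT u ->
  measurable_fun setT v -> measurable_fun setT w ->
  measurable_fun setT (fun x => (u x, v x, w x)).
Proof.
by move=> mu mv mw; apply: measurable_fun_pair => //; exact: measurable_fun_pair.
Qed.

Lemma measurable_cone_map i : measurable_fun setT (cone_map i).
Proof.
rewrite (_ : cone_map i = fun x =>
  match val i with
  | 0%N => (csum x, x.1.2, x.2) | 1%N => (x.1.1, csum x, x.2)
  | 2%N => (x.1.1, x.1.2, csum x)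
  | _ => (x.1.2 + x.2, x.1.1 + x.2, x.1.1 + x.1.2)
  end); last by apply/funext => -[[]].
have mt := measurable_csum.
by ord4 i => /=; apply: measurable_triple => //; exact: measurable_funD.
Qed.

Lemma measurable_bool_set (P : pt -> bool) : measurable_fun setT P ->
  measurable [set x | P x].
Proof.
by move=> mP; rewrite -[X in measurable X]setTI -preimage_true; exact: mP.
Qed.

Lemma measurable_branch i : measurable (branch i).
Proof.
have mh (u v : pt -> R) : measurable_fun setT u -> measurable_fun setT v ->
    measurable [set x | u x < v x].
  by move=> mu mv; apply: measurable_bool_set; exact: measurable_fun_ltr.
have mh' (u v : pt -> R) : measurable_fun setT u -> measurable_fun setT v ->
    measurable [set x | u x <= v x].
  by move=> mu mv; apply: measurable_bool_set; exact: measurable_fun_ler.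
ord4 i; rewrite /branch/=; apply: measurableI; try exact: measurable_Delta.
- rewrite (_ : mkset _ = [set x | 1 < 2 * x.1.1]); last by apply/seteqP; split => -[[]].
  by apply: mh => //; exact: measurable_funM.
- rewrite (_ : mkset _ = [set x | 1 < 2 * x.1.2]); last by apply/seteqP; split => -[[]].
  by apply: mh => //; exact: measurable_funM.
- rewrite (_ : mkset _ = [set x | 1 < 2 * x.2]); last by apply/seteqP; split => -[[]].
  by apply: mh => //; exact: measurable_funM.
- rewrite (_ : mkset _ = [set x | 2 * x.1.1 <= 1] `&` [set x | 2 * x.1.2 <= 1] `&`
    [set x | 2 * x.2 <= 1]); last first.
    by apply/seteqP; split => -[[a b] c] /= => [[]|[[]]]; do ?split.
  by apply: measurableI; [apply: measurableI|]; apply: mh' => //; exact: measurable_funM.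
Qed.

Lemma measurable_f_R : measurable_fun setT (f_R : pt -> pt).
Proof.
have minv := @measurable_invr R.
have mm i : measurable_fun setT (fun x => x \in branch i).
  apply: (measurable_fun_bool true); rewrite setTI (_ : _ @^-1` _ = branch i).
    exact: measurable_branch.
  by apply/seteqP; split => x /= => [/set_mem//|/mem_set].
have := mm (inord 0); rewrite /branch /= inordK//= => m0.
have := mm (inord 1); rewrite /branch /= inordK//= => m1.
have := mm (inord 2); rewrite /branch /= inordK//= => m2.
have := mm (inord 3); rewrite /branch /= inordK//= => m3.
rewrite (_ : f_R = fun x =>
  if x \in Delta1 then ((x.1.1 - x.1.2 - x.2) / x.1.1, x.1.2 / x.1.1, x.2 / x.1.1)
  else if x \in Delta2 then (x.1.1 / x.1.2, (- x.1.1 + x.1.2 - x.2) / x.1.2, x.2 / x.1.2)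
  else if x \in Delta3 then (x.1.1 / x.2, x.1.2 / x.2, (- x.1.1 - x.1.2 + x.2) / x.2)
  else if x \in Delta4 then (- x.1.1 + x.1.2 + x.2, x.1.1 - x.1.2 + x.2, x.1.1 + x.1.2 - x.2)
  else x); last by apply/funext => -[[]].
do !(apply: measurable_fun_ifT => //); apply: measurable_triple;
  do ?[apply: measurable_funM|apply: measurable_funB|apply: measurable_funD|
       apply: measurable_oppr|apply: (measurableT_comp minv)|exact: measurableT_comp] => //.
Qed.

End cone.

(** * Change of variables along the branches *)

Section transfer.
Context {R : realType}.
Local Notation leb := (@lebesgue_measure R).
Local Notation pt := (R * R * R)%type.
Local Open Scope ereal_scope.
Implicit Types (Phi : pt -> \bar R) (x y : pt) (i : 'I_4) (w : seq 'I_4).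

Definition swap02 x : pt := let: (a, b, c) := x in (c, b, a).

Lemma swap02E : swap02 = swap01 \o swap12 \o swap01.
Proof. by apply/funext => -[[]]. Qed.

Lemma measurable_swap02 : measurable_fun setT swap02.
Proof.
have m01 := @measurable_swap01 R; have m12 := @measurable_swap12 R.
rewrite swap02E; exact: (measurableT_comp (measurableT_comp m01 m12) m01).
Qed.

Lemma plane_integral_swap02 Phi : measurable_fun setT Phi ->
  (forall x, 0 <= Phi x) -> plane_integral Phi = plane_integral (Phi \o swap02).
Proof.
move=> mPhi Phi0; rewrite swap02E plane_integral_swap01//.
have m1 := measurableT_comp mPhi (@measurable_swap01 R).
have m2 := measurableT_comp m1 (@measurable_swap12 R).
by rewrite (plane_integral_swap12 m1 (fun=> Phi0 _)) (plane_integral_swap01 m2 (fun=> Phi0 _)).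
Qed.

Lemma plane_point_csum (z : R * R) : csum (plane_point z) = 1%R.
Proof. by rewrite /csum /=; ring. Qed.

Section branch_integral.
Variable Phi : pt -> \bar R.
Hypothesis mPhi : measurable_fun setT Phi.
Hypothesis Phi0 : forall x, 0 <= Phi x.
Hypothesis PhiD : forall x, ~ Delta x -> Phi x = 0.

(** Symmetry reduces the three vertex branches to one: the transposition [s] is applied once before
    and once after [vertex_pull]. *)
Lemma plane_integral_vertex_conj (s : pt -> pt) :
  (forall Psi, measurable_fun setT Psi -> (forall x, 0 <= Psi x) ->
     plane_integral Psi = plane_integral (Psi \o s)) ->
  measurable_fun setT s -> (forall x, Delta (s x) -> Delta x) ->
  plane_integral Phi = plane_integral (vertex_pull (Phi \o s) \o s).
Proof.
move=> Hs ms Ds; have mPs := measurableT_comp mPhi ms.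
have Ps0 x : 0 <= (Phi \o s) x by exact: Phi0.
have PsN x : (x.1.1 <= 0)%R -> (Phi \o s) x = 0.
  by move=> x0; apply: PhiD => /Ds; case: x x0 => -[a b] c /= a0 []; rewrite ltNge a0.
rewrite Hs// (plane_integral_vertex mPs Ps0 PsN) Hs//.
  exact: measurable_vertex_pull.
exact: vertex_pull_ge0.
Qed.

(** On the plane [csum x = 1], the projective map induced by a matrix [M] has Jacobian
    [|det M| / csum (M x) ^ 3]. *)
Lemma plane_integral_branch i : plane_integral Phi =
  plane_integral (fun x => (cone_det i * (csum (cone_map i x))^-1 ^+ 3)%R%:E *
                           Phi (inv_branch i x)).
Proof.
have m01 := @measurable_swap01 R; have m02 := measurable_swap02.
ord4 i.
- rewrite (@plane_integral_vertex_conj id)//.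
  apply: eq_integral => -[a b] _.
  rewrite /= /vertex_pull /inv_branch /scale /plane_point /cone_map /csum /=.
  rewrite (_ : a + b + (1 - a - b) = 1)%R; last by ring.
  rewrite (_ : 1 + b + (1 - a - b) = 2 - a)%R; last by ring.
  by rewrite mul1r mulr1 [(_ * b)%R]mulrC [(_^-1 * (1 - a - b))%R]mulrC.
- rewrite (@plane_integral_vertex_conj swap01)//; last 2 first.
  + by move=> Psi mPsi Psi0; exact: plane_integral_swap01.
  + by move=> -[[a b] c] [b0 a0 c0 abc]; split => //; lra.
  apply: eq_integral => -[a b] _.
  rewrite /= /vertex_pull /inv_branch /scale /plane_point /cone_map /csum /=.
  rewrite (_ : a + b + (1 - a - b) = 1)%R; last by ring.
  rewrite (_ : a + 1 + (1 - a - b) = 2 - b)%R; last by ring.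
  by rewrite mul1r mulr1 [(_ * a)%R]mulrC [(_^-1 * (1 - a - b))%R]mulrC.
- rewrite (@plane_integral_vertex_conj swap02)//; last 2 first.
  + by move=> Psi mPsi Psi0; exact: plane_integral_swap02.
  + by move=> -[[a b] c] [b0 a0 c0 abc]; split => //; lra.
  apply: eq_integral => -[a b] _.
  rewrite /= /vertex_pull /inv_branch /scale /plane_point /cone_map /csum /=.
  rewrite (_ : a + b + (1 - a - b) = 1)%R; last by ring.
  rewrite (_ : 2 - (1 - a - b) = a + b + 1)%R; last by ring.
  by rewrite mul1r mulr1 [(_^-1 * b)%R]mulrC [(_^-1 * a)%R]mulrC.
- rewrite plane_integral_center//; apply: eq_integral => -[a b] _.
  rewrite /= /inv_branch /scale /plane_point /cone_map /csum /=.
  rewrite (_ : b + (1 - a - b) + (a + (1 - a - b)) + (a + b) = 2)%R; last by ring.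
  rewrite /cone_det /=; by congr (_%:E * Phi (_, _, _)); field.
Qed.

End branch_integral.

(* Meant for [A] contained in [Delta]: outside the cone [G] may be negative. *)
Definition density_integral (G : pt -> R) (A : set pt) : \bar R :=
  plane_integral ((EFin \o G) \_ A).

Definition hom_density (G : pt -> R) : Prop :=
  [/\ measurable_fun setT G, forall x, cone x -> (0 <= G x)%R &
      forall t x, (0 < t)%R -> cone x -> G (scale t x) = (t^-1 ^+ 3 * G x)%R].

Lemma density_patch G A : hom_density G -> measurable A -> A `<=` Delta ->
  [/\ measurable_fun setT ((EFin \o G) \_ A),
     forall x, 0 <= ((EFin \o G) \_ A) x &
     forall x, ~ Delta x -> ((EFin \o G) \_ A) x = 0].
Proof.
move=> [mG G0 _] mA AD; split.
- by apply/(measurable_restrictT _ mA); apply/measurable_EFinP; exact: measurable_funTS.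
- by apply: erestrict_ge0 => x /AD/DeltaE[/G0]; rewrite lee_fin.
- by move=> x xD; rewrite patchE; case: ifPn => // /set_mem/AD.
Qed.

Lemma hom_density_cone_map G i : hom_density G -> hom_density (G \o cone_map i).
Proof.
move=> [mG G0 GZ]; split.
- exact: measurableT_comp mG (measurable_cone_map i).
- by move=> x cx; apply: G0; exact: cone_map_cone.
- move=> t x t0 cx /=; rewrite -GZ//; last exact: cone_map_cone.
  congr G; rewrite /scale /cone_map.
  by ord4 i; case: x cx => -[a b] c _ /=; congr (_, _, _); ring.
Qed.

Lemma measurable_preimage (A : set pt) : measurable A -> measurable (f_R @^-1` A).
Proof. by move=> mA; rewrite -[X in measurable X]setTI; exact: measurable_f_R. Qed.

(* [f_R] maps each of the four branches onto the whole simplex, so the integral of a homogeneous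
   density of degree -3 pulls back without any projective Jacobian left. *)
Lemma density_integral_branch G i A : hom_density G -> measurable A ->
  A `<=` Delta -> density_integral G (branch i `&` f_R @^-1` A) =
    (cone_det i)%:E * density_integral (G \o cone_map i) A.
Proof.
move=> hG mA AD; have [mG G0 GZ] := hG.
have mB : measurable (branch i `&` f_R @^-1` A).
  by apply: measurableI; [exact: measurable_branch|exact: measurable_preimage].
have BD : branch i `&` f_R @^-1` A `<=` Delta by move=> x [/branch_Delta].
have [mP P0 PD] := density_patch hG mB BD.
have d0 : (0 <= cone_det i :> R)%R by rewrite /cone_det; case: ifP.
have [mQ Q0 QD] := density_patch (hom_density_cone_map i hG) mA AD.
rewrite /density_integral (plane_integral_branch mP P0 PD i) /plane_integral.
rewrite -ge0_integralZl//; last first.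
  exact: (measurableT_comp mQ (@measurable_plane_point R)).
apply: eq_integral => z _; have := plane_point_csum z; move: (plane_point z) => x x1.
rewrite !patchE; case: ifPn => [/set_mem[Bi fA]|xB].
  have Ax : A x by rewrite -(f_R_inv_branch x1 Bi).
  rewrite mem_set//.
  have /AD/DeltaE[cx _] := Ax; have Mx := cone_map_cone i cx.
  rewrite /= /inv_branch GZ ?invr_gt0 ?csum_gt0// invrK -!EFinM; congr (_%:E).
  rewrite mulrA -(mulrA (cone_det i)) -exprMn mulVf ?gt_eqF ?csum_gt0//.
  by rewrite expr1n mulr1.
case: ifPn => [/set_mem Ax|]; last by rewrite !mule0.
have Dx := AD _ Ax; exfalso; move/negP : xB; apply; apply: mem_set.
have Bi := inv_branch_branch i Dx; split => //.
by rewrite /preimage/mkset f_R_inv_branch.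
Qed.

End transfer.

(** * The total mass *)

Section mass.
Context {R : realType}.
Local Notation leb := (@lebesgue_measure R).
Local Open Scope ereal_scope.
Implicit Types (F f g : R -> R) (a b l x t df dg : R).

(** Derivability of [f] stands in for its continuity, so that the tactic [derive] settles the
    hypotheses on both [F] and [f]. *)
Lemma integral_segment_derive F f a b : (a < b)%R ->
  (forall x, (a <= x <= b)%R -> is_derive x 1%R F (f x)) ->
  (forall x, (a <= x <= b)%R -> derivable f x 1%R) ->
  \int[leb]_(x in `[a, b]) (f x)%:E = (F b - F a)%:E.
Proof.
move=> ab dF df; have cF : {within `[a, b], continuous F}.
  by apply: derivable_within_continuous => x /[!in_itv]/= /dF/@ex_derive.
have [_ Fa Fb] := (continuous_within_itvP _ ab).1 cF.
rewrite (@continuous_FTC2 _ f F) ?EFinB//.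
- by apply: derivable_within_continuous => x /[!in_itv]/= /df.
- by split => // x /[!in_itv]/= /andP[/ltW ax /ltW xb]; apply: ex_derive; apply: dF; rewrite ax.
- move=> x /[!in_itv]/= /andP[/ltW ax /ltW xb]; rewrite derive1E.
  by apply: derive_val; apply: dF; rewrite ax.
Qed.

Lemma integral_ray_derive F f a l :
  (forall x, (a <= x)%R -> (0 <= f x)%R) ->
  (forall x, (a <= x)%R -> is_derive x 1%R F (f x)) ->
  (forall x, (a <= x)%R -> derivable f x 1%R) ->
  F x @[x --> +oo%R] --> l ->
  \int[leb]_(x in `[a, +oo[) (f x)%:E = (l - F a)%:E.
Proof.
move=> f0 dF df Fl; have cF : {within `[a, +oo[, continuous F}.
  by apply: derivable_within_continuous => x /[!in_itv]/= /andP[/dF/@ex_derive].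
have [_ Fa] := (continuous_within_itvcyP _ _).1 cF.
rewrite (@ge0_continuous_FTC2y _ f F a l) ?EFinB//.
- by apply: derivable_within_continuous => x /[!in_itv]/= /andP[/df].
- by move=> x /ltW ax; apply: ex_derive; exact: dF.
- move=> x /[!in_itv]/= /andP[/ltW ax _]; rewrite derive1E.
  by apply: derive_val; exact: dF.
Qed.

(** This rule and the next ones are stated on expressions in a bound variable, the form in which
    [derive] can apply them. *)
Lemma is_derive_add f g x df dg : is_derive x 1%R f df -> is_derive x 1%R g dg ->
  is_derive x 1%R (fun y => f y + g y)%R (df + dg)%R.
Proof. exact: is_deriveD. Qed.

Lemma is_derive_opp f x df : is_derive x 1%R f df ->
  is_derive x 1%R (fun y => - f y)%R (- df)%R.
Proof. exact: is_deriveN. Qed.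

Lemma is_derive_mul f g x df dg : is_derive x 1%R f df -> is_derive x 1%R g dg ->
  is_derive x 1%R (fun y => f y * g y)%R (f x * dg + g x * df)%R.
Proof. exact: is_deriveM. Qed.

Lemma is_derive_inv f x df : f x != 0%R -> is_derive x 1%R f df ->
  is_derive x 1%R (fun y => (f y)^-1)%R (- (f x) ^- 2 * df)%R.
Proof. by move=> f0 Df; exact: (is_deriveV f0 Df). Qed.

Lemma is_derive_sqr f x df : is_derive x 1%R f df ->
  is_derive x 1%R (fun y => f y ^+ 2)%R (f x * df + f x * df)%R.
Proof. by move=> Df; exact: (is_derive_mul Df Df). Qed.

Lemma is_derive_ln f x df : (0 < f x)%R -> is_derive x 1%R f df ->
  is_derive x 1%R (fun y => ln (f y)) ((f x)^-1 * df)%R.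
Proof.
move=> fx0 Df; apply: (@is_derive1_comp _ (@ln R) f) => //.
exact: is_derive1_ln.
Qed.

Lemma is_derive_atan f x df : is_derive x 1%R f df ->
  is_derive x 1%R (fun y => atan (f y)) ((1 + f x ^+ 2)^-1 * df)%R.
Proof. by move=> Df; apply: (@is_derive1_comp _ (@atan R) f). Qed.

Ltac derive := repeat first [ exact: is_derive_cst | exact: is_derive_id
 | apply: is_derive_add | apply: is_derive_opp | apply: is_derive_mul
 | apply: is_derive_sqr | apply: is_derive_inv | apply: is_derive_ln | apply: is_derive_atan ].

(** Partial fractions: the integrand is [((1 - b)^-1 + (a + b)^-1) / (1 + a)]. Up to a factor
    depending on [a] only, this is the integral of [h] along the line [x0 = a]. *)
Lemma integral_log a : (0 < a < 1)%R ->
  \int[leb]_(b in `[0%R, (1 - a)%R]) (((1 - b) * (a + b))^-1)%R%:E =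
  (- 2 * ln a / (1 + a))%:E.
Proof.
move=> /andP[a0 a1].
pose F x := ((1 + a)^-1 * (ln (a + x) - ln (1 - x)))%R.
transitivity (F (1 - a) - F 0)%:E%R; last first.
  rewrite /F addr0 subr0 ln1 addrCA subrr addr0 ln1.
  rewrite (_ : (1 - (1 - a)) = a)%R; last by ring.
  by congr EFin; ring.
apply: integral_segment_derive => [|x /andP[x0 x1]|x /andP[x0 x1]].
- by rewrite subr_gt0.
- rewrite /F; apply: is_derive_eq.
    derive; lra.
  rewrite /=. field. by apply/and3P; split; lra.
- apply: ex_derive; derive. rewrite mulf_neq0//; lra.
Qed.

(** Turns the logarithm left by [integral_log] into the integral of a rational function, so that
    Tonelli can be used a second time. A primitive is [ln ((1 + t^2) / (1 + a^2 t^2)) / (1 -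
    a^2)]. *)
Lemma integral_ray a : (0 < a < 1)%R ->
  \int[leb]_(t in `[0%R, +oo[)
    (2 * t / ((1 + t ^+ 2) * (1 + a ^+ 2 * t ^+ 2)))%:E =
  (- 2 * ln a / (1 - a ^+ 2))%:E.
Proof.
move=> /andP[a0 a1]; have aa : (a ^+ 2 < 1)%R by rewrite expr_lt1 ?ltW.
have aa0 : (0 < a ^+ 2)%R by rewrite exprn_gt0.
have P t : (0 < 1 + a ^+ 2 * t ^+ 2)%R.
  by rewrite -exprMn ltr_pwDl// sqr_ge0.
have Q t : (0 < 1 + t ^+ 2)%R by rewrite ltr_pwDl// sqr_ge0.
have a10 : (1 - a ^+ 2 != 0)%R by rewrite gt_eqF// subr_gt0.
(* The argument of the logarithm, decomposed so that its limit [a ^- 2] at infinity is visible. *)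
pose u t := (a ^- 2 + (1 - a ^- 2) * (1 + a ^+ 2 * t ^+ 2)^-1)%R.
have uE t : u t = ((1 + t ^+ 2) / (1 + a ^+ 2 * t ^+ 2))%R.
  by rewrite /u; field; rewrite !gt_eqF.
have u0 t : (0 < u t)%R by rewrite uE divr_gt0.
pose F t := ((1 - a ^+ 2)^-1 * ln (u t))%R.
transitivity ((- 2 * ln a / (1 - a ^+ 2)) - F 0)%:E%R; last first.
  by rewrite /F uE expr0n/= mulr0 addr0 divr1 ln1 mulr0 subr0.
apply: integral_ray_derive => [t t0|t t0|t t0|].
- by rewrite divr_ge0 ?mulr_ge0// ltW.
- rewrite /F; apply: is_derive_eq.
    derive; first exact: u0.
    by rewrite gt_eqF.
  rewrite -/(u _) uE /GRing.scale/=; field.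
  rewrite a10 !gt_eqF//=.
- by apply: ex_derive; derive; rewrite mulf_neq0// gt_eqF.
- have -> : (- 2 * ln a / (1 - a ^+ 2) = (1 - a ^+ 2)^-1 * ln (a ^- 2))%R.
    by rewrite lnV ?posrE// lnXn// -mulr_natl; ring.
  apply: cvgM; first exact: cvg_cst.
  apply: continuous_cvg; first by apply: continuous_ln; rewrite invr_gt0.
  rewrite -[X in _ --> X]addr0; apply: cvgD; first exact: cvg_cst.
  rewrite -[X in _ --> X](mulr0 (1 - a ^- 2)%R); apply: cvgM; first exact: cvg_cst.
  apply/gtr0_cvgV0; first by apply: nearW => x; exact: P.
  apply: (@ger_cvgy _ _ _ _ (fun x => a ^+ 2 * x ^+ 2)%R).
    by apply: nearW => x; rewrite lerDr.
  by apply: gt0_cvgMry => //; exact: cvgr_expr2.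
Qed.

Lemma integral_atan_line t : (0 < t)%R ->
  \int[leb]_(a in `[0%R, 1%R]) ((1 + a ^+ 2 * t ^+ 2)^-1)%R%:E = (atan t / t)%:E.
Proof.
move=> t0; pose F a := (atan (a * t) / t)%R.
have P a : (0 < 1 + a ^+ 2 * t ^+ 2)%R by rewrite -exprMn ltr_pwDl// sqr_ge0.
transitivity (F 1 - F 0)%:E%R; last by rewrite /F mul1r mul0r atan0 mul0r subr0.
apply: integral_segment_derive => [//|x /andP[x0 x1]|x /andP[x0 x1]].
- rewrite /F; apply: is_derive_eq; first derive.
  by rewrite /GRing.scale/=; field; rewrite -?exprMn ?gt_eqF//= ?exprMn.
- by apply: ex_derive; derive; rewrite gt_eqF.
Qed.

Lemma integral_atan_ray :
  \int[leb]_(t in `[0%R, +oo[) (2 * atan t / (1 + t ^+ 2))%:E = ((pi / 2) ^+ 2)%:E :> \bar R.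
Proof.
have Q t : (0 < 1 + t ^+ 2)%R by rewrite ltr_pwDl// sqr_ge0.
pose F t := (atan t ^+ 2)%R.
transitivity ((pi / 2) ^+ 2 - F 0)%:E%R; last by rewrite /F atan0 expr0n subr0.
apply: integral_ray_derive => [t t0|t t0|t t0|].
- apply: divr_ge0; [apply: mulr_ge0 => //|exact: ltW].
  by have := le_atan t0; rewrite atan0.
- rewrite /F; apply: is_derive_eq; first derive.
  by rewrite /GRing.scale/=; field; rewrite gt_eqF.
- by apply: ex_derive; derive; rewrite gt_eqF.
- by apply: cvgM; exact: cvgy_atan.
Qed.

(** The integrand is expanded by [integral_ray]; after exchanging the integrals,
    [integral_atan_line] gives the integrand of [integral_atan_ray]. The indicators in [g] make the
    kernel nonnegative on the whole plane. *)
Lemma integral_log_ray :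
  \int[leb]_(a in `]0%R, 1%R[) (- 2 * ln a / (1 - a ^+ 2))%:E =
  ((pi / 2) ^+ 2)%:E :> \bar R.
Proof.
have P a t : (0 < 1 + a ^+ 2 * t ^+ 2)%R by rewrite -exprMn ltr_pwDl// sqr_ge0.
have Q t : (0 < 1 + t ^+ 2)%R by rewrite ltr_pwDl// sqr_ge0.
pose I : set R := `]0%R, 1%R[%classic; pose J : set R := `[0%R, +oo[%classic.
pose g (z : R * R) := ((\1_I z.1 * (\1_J z.2 * (2 * z.2)))%R /
  ((1 + z.2 ^+ 2) * (1 + z.1 ^+ 2 * z.2 ^+ 2)))%R%:E.
have mI : measurable_fun setT (\1_I : R -> R).
  by apply: measurable_indic; exact: measurable_itv.
have mJ : measurable_fun setT (\1_J : R -> R).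
  by apply: measurable_indic; exact: measurable_itv.
have mg : measurable_fun setT g.
  apply/measurable_EFinP; apply: measurable_funM.
    apply: measurable_funM; first exact: measurableT_comp.
    apply: measurable_funM; first exact: measurableT_comp.
    exact: measurable_funM.
  apply: (measurableT_comp (@measurable_invr R)).
  apply: measurable_funM; apply: measurable_funD => //; first exact: measurable_funX.
  by apply: measurable_funM; apply: measurable_funX.
have J0 t : (0 <= \1_J t * (2 * t) :> R)%R.
  rewrite indicE mem_setE/= in_itv/= andbT.
  by case: (leP 0%R t) => t0 /=; [rewrite !mulr_ge0|rewrite mul0r].
have g0 z : 0 <= g z.
  rewrite lee_fin. apply: divr_ge0; first by apply: mulr_ge0. by apply: mulr_ge0; apply: ltW.
transitivity (\int[leb]_a \int[leb]_t g (a, t)).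
  rewrite integral_mkcond; apply: eq_integral => a _.
  rewrite patchE mem_setE/= in_itv/=; case: ifPn => [a01|/negbTE a01].
    rewrite -integral_ray//; rewrite [LHS]integral_mkcond; apply: eq_integral => t _.
    rewrite patchE /g/= !indicE !mem_setE/= !in_itv/= a01 mul1r andbT.
    by case: ifPn => _; rewrite ?mul1r// !mul0r.
  rewrite integral0_eq// => t _.
  by rewrite /g/= indicE mem_setE/= in_itv/= a01 !mul0r.
rewrite (@fubini_tonelli _ _ _ _ R leb leb g mg g0) -integral_atan_ray.
rewrite [RHS]integral_mkcond; apply: eq_integral => t _.
rewrite patchE mem_setE/= in_itv/= andbT; case: ifPn => [t0|/negbTE t0]; last first.
  rewrite integral0_eq// => a _.
  by rewrite /g/= [\1_J t]indicE mem_setE/= in_itv/= andbT t0 mul0r mulr0 mul0r.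
(* The case [t = 0] is separate because the factor [atan t / t] is about to appear; both sides
   vanish there. *)
have [->|tn0] := eqVneq t 0%R.
  by rewrite integral0_eq ?atan0 ?mulr0 ?mul0r// => a _; rewrite /g/= !mulr0 mul0r.
have {tn0}t0 : (0 < t)%R by rewrite lt_neqAle eq_sym tn0.
rewrite (_ : (2 * atan t / (1 + t ^+ 2)) = (2 * t / (1 + t ^+ 2)) * (atan t / t))%R; last first.
  by field; rewrite !gt_eqF.
have mq : measurable_fun setT (fun a : R => ((1 + a ^+ 2 * t ^+ 2)^-1)%R%:E).
  apply/measurable_EFinP; apply: (measurableT_comp (@measurable_invr R)).
  by apply: measurable_funD => //; apply: measurable_funM => //; exact: measurable_funX.
rewrite EFinM -integral_atan_line// integral_itv_bndoo; last exact: measurable_funTS.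
rewrite -ge0_integralZl//; last 3 first.
- exact: measurable_funTS.
- by move=> a _; rewrite lee_fin invr_ge0 ltW.
- by rewrite lee_fin divr_ge0 ?mulr_ge0 ?ltW.
rewrite [RHS]integral_mkcond; apply: eq_integral => a _.
rewrite patchE /g/= !indicE !mem_setE/= !in_itv/= andbT (ltW t0).
case: ifPn => _; last by rewrite !mul0r.
by rewrite !mul1r -EFinM; congr EFin; field; rewrite -?exprMn !gt_eqF//= exprMn.
Qed.

(** Integrating over [x1] is [integral_log], then over [x0] is [integral_log_ray]; the constant
    [4 / pi ^+ 2] is the inverse of the value [(pi / 2) ^+ 2]. *)
Lemma mu_Delta : @mu R Delta = 1.
Proof.
rewrite /mu setIid integral_mkcond; set H := (_ \_ _).
have mD : measurable (plane_point @^-1` (@Delta R)).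
  by rewrite -[X in measurable X]setTI; apply: measurable_plane_point => //; exact: measurable_Delta.
have mH : measurable_fun setT H.
  apply/(measurable_restrictT _ mD)/measurable_EFinP; apply: measurable_funTS.
  exact: measurableT_comp measurable_h measurable_plane_point.
have H0 z : 0 <= H z by apply: erestrict_ge0 => x Dx; rewrite lee_fin h_ge0.
rewrite (@fubini_tonelli1 _ _ _ _ R leb leb H mH H0).
have pi0 : (pi != 0 :> R)%R by rewrite gt_eqF// pi_gt0.
rewrite (_ : 1 = (4 / pi ^+ 2)%R%:E * ((pi / 2) ^+ 2)%:E); last first.
  by rewrite -EFinM; congr EFin; move: (pi : R) pi0 => p p0; field; exact: p0.
rewrite -integral_log_ray -ge0_integralZl//; last 3 first.
- apply/measurable_EFinP; apply: measurable_funTS; apply: measurable_funM.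
    by apply: measurable_funM => //; exact: measurable_ln.
  apply: (measurableT_comp (@measurable_invr R)); apply: measurable_funB => //.
- move=> a /=; rewrite in_itv/= => /andP[a0 a1]; rewrite lee_fin.
  apply: divr_ge0; last by rewrite subr_ge0 expr_le1 ?ltW.
  rewrite mulNr oppr_ge0.
  by rewrite mulr_ge0_le0// ln_le0// ltW.
- by rewrite lee_fin divr_ge0// sqr_ge0.
rewrite [RHS]integral_mkcond; apply: eq_integral => a _.
rewrite patchE mem_setE/= in_itv/= /fubini_F; case: ifPn => [a01|/negbTE a01]; last first.
  rewrite integral0_eq// => b _; rewrite /H patchE memNset//= => -[a0 b0 c0 _].
  by move: a01; rewrite a0/= => /negbT; rewrite -leNgt; lra.
have /andP[a0 a1] := a01.
have a10 : (1 - a != 0)%R by rewrite gt_eqF// subr_gt0.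
rewrite -EFinM.
rewrite (_ : (4 / pi ^+ 2 * (- 2 * ln a / (1 - a ^+ 2))) =
  (4 / pi ^+ 2 / (1 - a)) * (- 2 * ln a / (1 + a)))%R; last first.
  have a11 : (1 + a != 0)%R by rewrite gt_eqF//; lra.
  rewrite (_ : 1 - a ^+ 2 = (1 - a) * (1 + a))%R; last by ring.
  by move: (pi : R) pi0 => p p0; field; rewrite a11 a10 p0.
rewrite EFinM -integral_log//.
have mq : measurable_fun setT (fun b : R => (((1 - b) * (a + b))^-1)%R%:E).
  apply/measurable_EFinP; apply: (measurableT_comp (@measurable_invr R)).
  by apply: measurable_funM; [apply: measurable_funB|apply: measurable_funD].
rewrite integral_itv_bndoo; last exact: measurable_funTS.
rewrite -ge0_integralZl//; last 3 first.
- exact: measurable_funTS.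
- move=> b /=; rewrite in_itv/= => /andP[b0 b1].
  by rewrite lee_fin invr_ge0 mulr_ge0//; lra.
- rewrite lee_fin divr_ge0 ?divr_ge0 ?sqr_ge0//; lra.
rewrite [RHS]integral_mkcond; apply: eq_integral => b _.
rewrite /H !patchE.
have -> : ((a, b) \in plane_point @^-1` Delta) = (b \in `]0%R, (1 - a)%R[%classic).
  apply/idP/idP => [/set_mem|/set_mem /=].
    case=> /= _ b0 c0 _; apply/mem_set; rewrite /= in_itv/= b0/=; lra.
  rewrite in_itv/= => /andP[b0 b1]; apply/mem_set; split => //=; lra.
case: ifPn => // /set_mem /=; rewrite in_itv/= => /andP[b0 b1].
rewrite -EFinM; congr EFin.
rewrite (_ : 1 - (1 - a - b) = a + b)%R; last by ring.
by move: (pi : R) pi0 => p p0; field; rewrite p0 a10 !gt_eqF//=; lra.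
Qed.

End mass.

(** * Invariance *)

Section invariance.
Context {R : realType}.
Local Notation leb := (@lebesgue_measure R).
Local Notation pt := (R * R * R)%type.
Local Notation mu := (@mu R).
Local Open Scope ereal_scope.
Implicit Types (x y : pt) (i : 'I_4) (w : seq 'I_4) (A : set pt).

(* Homogeneous of degree -3, and equal to [h] on [Delta]. *)
Definition mu_density x : R :=
  (4 / (pi ^+ 2 * (x.1.2 + x.2) * (x.1.1 + x.2) * (x.1.1 + x.1.2)))%R.

Lemma hom_mu_density : hom_density mu_density.
Proof.
split.
- apply: measurable_funM => //; apply: (measurableT_comp (@measurable_invr R)).
  have m1 := @measurable_fst_fst R; have m2 := @measurable_fst_snd R.
  apply: measurable_funM; last exact: measurable_funD.
  apply: measurable_funM; last exact: measurable_funD.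
  by apply: measurable_funM => //; exact: measurable_funD.
- case=> -[a b] c [/= a0 b0 c0].
  by rewrite divr_ge0// !mulr_ge0 ?pi_ge0//=; lra.
- move=> t [[a b] c] t0 [/= a0 b0 c0]; rewrite /mu_density/=.
  have p0 : (pi != 0 :> R)%R by rewrite gt_eqF// pi_gt0.
  move: (pi : R) p0 => p p0; field.
  by rewrite p0 !gt_eqF//= ?addr_gt0 ?mulr_gt0.
Qed.

Lemma muE A : mu A = density_integral mu_density (Delta `&` A).
Proof.
rewrite /Defs.mu integral_mkcond; apply: eq_integral => z _; rewrite !patchE.
rewrite /preimage/=; set P := (_ \in _); set Q := (_ \in _).
have -> : P = Q by apply/idP/idP => /set_mem H; apply/mem_set.
case: ifP => //= /set_mem [_ _].
by congr (_%:E); rewrite /mu_density /=; congr (4 / (_ * _ * _ * _))%R; ring.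
Qed.

Lemma mu_DeltaI A : mu (Delta `&` A) = mu A.
Proof. by rewrite !muE setIA setIid. Qed.

Lemma mu_notDelta : mu (~` Delta) = 0.
Proof. by rewrite muE setICr /density_integral patch_set0; exact: integral0. Qed.

Lemma mu_setT : mu setT = 1.
Proof. by rewrite -mu_DeltaI setIT mu_Delta. Qed.

Lemma mu_le1 A : measurable A -> mu A <= 1.
Proof. by move=> mA; rewrite -mu_setT le_measure ?inE. Qed.

Lemma mu_fin A : measurable A -> mu A \is a fin_num.
Proof.
by move=> mA; rewrite ge0_fin_numE// (le_lt_trans (mu_le1 mA))// ltry.
Qed.

Lemma mu_null_subset A B : measurable A -> measurable B -> A `<=` B ->
  mu B = 0 -> mu A = 0.
Proof. exact: subset_measure0. Qed.

(** The density is a fixed point of the transfer operator of [f_R]; homogeneity has absorbed the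
    Jacobians, leaving only the determinants as weights. *)
Lemma mu_density_transfer x : Delta x ->
  (\sum_(i < 4) cone_det i * mu_density (cone_map i x))%R = mu_density x.
Proof.
move=> Dx; rewrite !big_ord_recr big_ord0/= add0r /mu_density /cone_det /cone_map.
case: x Dx => -[a b] c [a0 b0 c0 abc] /=.
have p0 : (pi != 0 :> R)%R by rewrite gt_eqF// pi_gt0.
move: (pi : R) p0 => p p0.
rewrite (_ : c = 1 - a - b)%R; last by lra.
field. rewrite p0 /= !gt_eqF//=; lra.
Qed.

Lemma density_integral_sum G (d : 'I_4 -> R) (H : 'I_4 -> pt -> R) A :
  measurable A -> A `<=` Delta -> (forall i, 0 <= d i)%R ->
  (forall i, hom_density (H i)) ->
  (forall x, Delta x -> G x = \sum_(i < 4) d i * H i x)%R ->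
  density_integral G A = \sum_(i < 4) (d i)%:E * density_integral (H i) A.
Proof.
move=> mA AD d0 hH GE.
have mp i := density_patch (hH i) mA AD.
rewrite /density_integral /plane_integral.
under [RHS]eq_bigr => i _.
  have [m0 p0 _] := mp i.
  rewrite -ge0_integralZl//; last 2 first.
  - exact: (measurableT_comp m0 (@measurable_plane_point R)).
  - by rewrite lee_fin.
  over.
rewrite -ge0_integral_sum//; last 2 first.
- move=> i; have [m0 p0 _] := mp i.
  apply: emeasurable_funM => //.
  exact: (measurableT_comp m0 (@measurable_plane_point R)).
- by move=> i z _; have [m0 p0 _] := mp i; rewrite mule_ge0// lee_fin.
apply: eq_integral => z _; rewrite patchE; case: ifPn => [/set_mem Az|Az].
  rewrite /= GE; last exact: AD.
  rewrite -sumEFin; apply: eq_bigr => i _.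
  by rewrite EFinM patchE mem_set.
by rewrite big1// => i _; rewrite patchE (negbTE Az) mule0.
Qed.

(** The preimage is cut along the four branches; [density_integral_branch] pulls each piece back to
    [A], and [mu_density_transfer] sums the resulting densities. *)
Lemma mu_preimage A : measurable A -> A `<=` Delta -> mu (f_R @^-1` A) = mu A.
Proof.
move=> mA AD; have mfA := measurable_preimage mA.
have -> : mu (f_R @^-1` A) = \sum_(i < 4) mu (branch i `&` f_R @^-1` A).
  rewrite -mu_DeltaI.
  rewrite (_ : _ `&` _ = \big[setU/set0]_(i < 4) (branch i `&` f_R @^-1` A)).
    rewrite measure_semi_additive_ord//.
    - by move=> i; apply: measurableI => //; exact: measurable_branch.
    - by move=> i j _ _ [x [[Bi _] [Bj _]]]; exact: branch_inj Bi Bj.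
    - apply: bigsetU_measurable => i _.
      by apply: measurableI => //; exact: measurable_branch.
  apply/seteqP; split => [x [/branchP[i Bi] Ax]|].
    by rewrite (bigD1 i)//=; left.
  apply: (big_ind (fun B => B `<=` _)) => // [B C BP CP|i _ x [/branch_Delta]//].
  by rewrite subUset.
rewrite muE (setIidr AD) (@density_integral_sum _ (@cone_det R) (fun i => mu_density \o cone_map i))//.
- apply: eq_bigr => i _; rewrite muE setIA (setIidr (@branch_Delta R i)).
  by rewrite density_integral_branch//; exact: hom_mu_density.
- by move=> i; rewrite /cone_det; case: ifP.
- by move=> i; apply: hom_density_cone_map; exact: hom_mu_density.
- by move=> x /mu_density_transfer.
Qed.

Lemma mu_preserving : measure_preserving mu f_R.
Proof.
split; first exact: measurable_f_R.
have mD := @measurable_Delta R; have mfD := measurable_preimage mD.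
(* The preimage of [Delta] already has the full mass 1, so the points sent outside [Delta] form a
   null set. *)
have fD : mu (f_R @^-1` (~` Delta)) = 0.
  have : mu setT = mu (f_R @^-1` (~` Delta)) + mu (f_R @^-1` Delta).
    by rewrite [LHS](measureDI mu measurableT mfD) setTI setTD -preimage_setC.
  rewrite (mu_preimage mD (@subset_refl _ _)) mu_setT mu_Delta.
  have := mu_fin (measurable_preimage (measurableC mD)).
  case: (mu _) => // r _ [] r1; congr EFin; lra.
move=> A mA; rewrite -[RHS]mu_DeltaI -mu_preimage; last by move=> ? [].
  rewrite (measureDI mu (measurable_preimage mA) mfD) -preimage_setI [X in X + _](_ : _ = 0).
    by rewrite add0e setIC.
  apply: mu_null_subset fD => //.
  - by apply: measurableD => //; exact: measurable_preimage.
  - exact: (measurable_preimage (measurableC mD)).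
by apply: measurableI.
Qed.

End invariance.

(** * Cylinders and bounded distortion *)

Section cylinders.
Context {R : realType}.
Local Notation leb := (@lebesgue_measure R).
Local Notation pt := (R * R * R)%type.
Local Notation mu := (@mu R).
Local Notation f := (@f_R R).
Local Open Scope ereal_scope.
Implicit Types (x y z : pt) (i : 'I_4) (w u v : seq 'I_4) (A B : set pt).

(** The target [A] constrains the iterate reached after reading [w]; keeping it as a parameter turns
    concatenation of words into composition. *)
Fixpoint cyl w A : set pt :=
  if w is i :: w' then branch i `&` f @^-1` cyl w' A else A.

Definition cone_word w x := foldr (@cone_map R) x w.

Definition word_det w : R := (\prod_(i <- w) cone_det i)%R.

Lemma measurable_cyl w A : measurable A -> measurable (cyl w A).
Proof.
move=> mA; elim: w => //= i w IH.
by apply: measurableI; [exact: measurable_branch|exact: measurable_preimage].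
Qed.

Lemma cyl_Delta w A : A `<=` Delta -> cyl w A `<=` Delta.
Proof. by case: w => //= i w _ x [/branch_Delta]. Qed.

Lemma cyl_cat u v A : cyl (u ++ v) A = cyl u (cyl v A).
Proof. by elim: u => //= i u ->. Qed.

Lemma cylP w A x : cyl w A x <-> cyl w setT x /\ A (iter (size w) f x).
Proof.
elim: w x => [|i w IH] x /=; first by split => // -[].
rewrite /preimage/= -iterS iterSr; split=> [[Bi /IH[]]|[[Bi cx] Ax]]; first by do !split.
by split => //; apply/IH.
Qed.

Lemma cone_word_cat u v x : cone_word (u ++ v) x = cone_word u (cone_word v x).
Proof. exact: foldr_cat. Qed.

Lemma cone_word_cone w x : cone x -> cone (cone_word w x).
Proof. by move=> cx; elim: w => //= i w; exact: cone_map_cone. Qed.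

Lemma word_det_gt0 w : (0 < word_det w)%R.
Proof.
rewrite /word_det; apply: (big_ind (fun t : R => 0 < t)%R) => //.
  exact: mulr_gt0.
by move=> i _; rewrite /cone_det; case: ifP.
Qed.

Lemma hom_density_cone_word G w : hom_density G -> hom_density (G \o cone_word w).
Proof.
move=> hG; elim: w G hG => [//|i w IH] G hG.
exact: (IH _ (hom_density_cone_map i hG)).
Qed.

Lemma density_integral_cyl G w A : hom_density G -> measurable A ->
  A `<=` Delta -> density_integral G (cyl w A) =
    (word_det w)%:E * density_integral (G \o cone_word w) A.
Proof.
move=> hG mA AD; elim: w G hG => [|i w IH] G hG.
  by rewrite /word_det big_nil mul1e.
rewrite /= density_integral_branch//; last 2 first.
- exact: measurable_cyl.
- exact: cyl_Delta.
rewrite IH; last exact: hom_density_cone_map.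
by rewrite /word_det big_cons EFinM muleA.
Qed.

Lemma mu_cyl w A : measurable A -> A `<=` Delta ->
  mu (cyl w A) = (word_det w)%:E * density_integral (mu_density \o cone_word w) A.
Proof.
move=> mA AD; rewrite muE (setIidr (cyl_Delta AD)).
by apply: density_integral_cyl => //; exact: hom_mu_density.
Qed.

Definition vadd x y : pt := (x.1.1 + y.1.1, x.1.2 + y.1.2, x.2 + y.2)%R.

Definition vle x y : Prop := [/\ (x.1.1 <= y.1.1)%R, (x.1.2 <= y.1.2)%R & (x.2 <= y.2)%R].

Definition ones : pt := (1, 1, 1)%R.

Lemma cone_ones : cone ones. Proof. by split => /=. Qed.

Lemma cone_word_vadd w x y :
  cone_word w (vadd x y) = vadd (cone_word w x) (cone_word w y).
Proof.
elim: w => //= i w ->; move: (cone_word w x) (cone_word w y) => {x y} x y.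
rewrite /vadd /cone_map.
by ord4 i; case: x => -[a b] c; case: y => -[a' b'] c' /=; congr (_, _, _); ring.
Qed.

Lemma cone_word_scale w t x : cone_word w (scale t x) = scale t (cone_word w x).
Proof.
elim: w => //= i w ->; move: (cone_word w x) => {x} x.
rewrite /scale /cone_map.
by ord4 i; case: x => -[a b] c /=; congr (_, _, _); ring.
Qed.

Lemma cone_word_vle w x y : vle x y -> vle (cone_word w x) (cone_word w y).
Proof.
move=> xy; elim: w => //= i w; move: (cone_word w x) (cone_word w y) => {xy}x {}y.
rewrite /vle /cone_map.
by ord4 i; case: x => -[a b] c; case: y => -[a' b'] c' /= [? ? ?]; split; lra.
Qed.

Lemma mu_density_anti x y : cone x -> vle x y -> (mu_density y <= mu_density x)%R.
Proof.
case: x => -[a b] c; case: y => -[a' b'] c' [/= a0 b0 c0] [/= aa bb cc].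
have p0 : (0 < pi ^+ 2 :> R)%R by rewrite exprn_gt0// pi_gt0.
rewrite /mu_density/=; move: (pi ^+ 2 : R)%R p0 => p p0.
rewrite ler_pM2l// lef_pV2 ?posrE ?mulr_gt0//; try lra.
apply: ler_pM; [rewrite !mulr_ge0 ?(ltW p0)//; lra|lra| |lra].
apply: ler_pM; [rewrite mulr_ge0 ?(ltW p0)//; lra|lra| |lra].
by rewrite ler_pM2l//; lra.
Qed.

Definition central : 'I_4 := inord 3.

Definition double_central : seq 'I_4 := [:: central; central].

Lemma cone_double_central x :
  cone_word double_central x = vadd x (scale (csum x) ones).
Proof.
case: x => -[a b] c; rewrite /= /cone_map /central /= !inordK//=.
by rewrite /vadd /scale /csum/=; congr (_, _, _); ring.
Qed.

(** On [Delta] the map is translation by [ones], so all coordinates of the images lie between 1 and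
    2. *)
Lemma double_central_vle x y : Delta x -> Delta y ->
  vle (cone_word double_central x) (scale 2 (cone_word double_central y)).
Proof.
move=> /DeltaE[[+ + +] +] /DeltaE[[+ + +] +]; rewrite !cone_double_central.
case: x => -[a b] c; case: y => -[a' b'] c'; rewrite /vle /csum/=.
by move=> *; split; lra.
Qed.

(* A word ending in [double_central] has bounded distortion because the two matrices
   together map the simplex into a compact part of the cone. *)
Lemma mu_density_distortion w x y : Delta x -> Delta y ->
  (mu_density (cone_word (w ++ double_central) x) <=
   8 * mu_density (cone_word (w ++ double_central) y))%R.
Proof.
move=> Dx Dy; have [cx _] := (DeltaE x).1 Dx; have [cy _] := (DeltaE y).1 Dy.
rewrite !cone_word_cat; set X := cone_word w _; set Y := cone_word w _.
have [_ _ hS] := @hom_mu_density R.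
have cX : cone X by do 2 apply: cone_word_cone.
have cY : cone Y by do 2 apply: cone_word_cone.
have YX : vle Y (scale 2 X).
  by rewrite -cone_word_scale; apply: cone_word_vle; exact: double_central_vle.
(* The factor 2 of [double_central_vle] becomes [8 = 2 ^ 3] by homogeneity of degree -3. *)
have := mu_density_anti cY YX; rewrite hS// => H.
rewrite -ler_pdivrMl// (le_trans _ H)//.
by rewrite ler_wpM2r//; [have [_ + _] := @hom_mu_density R; apply|lra].
Qed.

(** Area in the coordinates [(x0, x1)]: the reference with which the densities on all cylinders are
    compared. *)
Definition vol A : \bar R := density_integral (fun=> 1%R) A.

Lemma le_density_integral (G H : pt -> R) A : measurable A -> measurable_fun setT G ->
  measurable_fun setT H -> (forall x, A x -> 0 <= G x <= H x)%R ->
  density_integral G A <= density_integral H A.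
Proof.
move=> mA mG mH GH.
have mr (K : pt -> R) : measurable_fun setT K ->
    measurable_fun setT (((EFin \o K) \_ A) \o plane_point).
  move=> mK; apply: measurableT_comp; last exact: measurable_plane_point.
  by apply/(measurable_restrictT _ mA); apply/measurable_EFinP; exact: measurable_funTS.
apply: ge0_le_integral => //; do ?exact: mr.
- move=> z _; rewrite patchE; case: ifPn => // /set_mem Az.
  by rewrite lee_fin; have /andP[] := GH _ Az.
- move=> z _; rewrite !patchE; case: ifPn => // /set_mem Az.
  by rewrite lee_fin; have /andP[] := GH _ Az.
Qed.

Lemma density_integral_cst (k : R) A : measurable A -> (0 <= k)%R ->
  density_integral (fun=> k) A = k%:E * vol A.
Proof.
move=> mA k0; rewrite /vol /density_integral /plane_integral -ge0_integralZl//.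
- apply: eq_integral => z _; rewrite !patchE; case: ifP; rewrite ?mule0//.
  by rewrite mule1.
- apply: (measurableT_comp _ (@measurable_plane_point R)).
  by apply/(measurable_restrictT _ mA); apply/measurable_EFinP.
- by move=> z _; rewrite patchE; case: ifP.
Qed.

Lemma vol_ge0 A : 0 <= vol A.
Proof. by apply: integral_ge0 => z _; rewrite patchE; case: ifP. Qed.

(** On [Delta] the sum of two coordinates is at most 1, hence [mu_density] is at least
    [4 / pi ^+ 2]. *)
Lemma vol_le_mu A : measurable A -> A `<=` Delta ->
  vol A <= (pi ^+ 2 / 4)%R%:E * mu A.
Proof.
move=> mA AD; have p0 : (0 < pi ^+ 2 :> R)%R by rewrite exprn_gt0// pi_gt0.
have hd := @hom_mu_density R; have [md _ _] := hd.
have k0 : (0 <= pi ^+ 2 / 4 :> R)%R by rewrite divr_ge0// ltW.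
rewrite muE (setIidr AD).
have [mp pge _] := density_patch hd mA AD.
rewrite /density_integral /plane_integral -ge0_integralZl//; last first.
  exact: (measurableT_comp mp (@measurable_plane_point R)).
rewrite -[leRHS]/(plane_integral (fun x => (pi ^+ 2 / 4)%R%:E * ((EFin \o mu_density) \_ A) x)).
have -> : (fun x => (pi ^+ 2 / 4)%R%:E * ((EFin \o mu_density) \_ A) x) =
    (EFin \o (fun x => (pi ^+ 2 / 4) * mu_density x)%R) \_ A.
  by apply/funext => x; rewrite !patchE; case: ifP; rewrite ?mule0// EFinM.
apply: le_density_integral => //; first exact: measurable_funM.
case=> -[a b] c /AD [a0 b0 c0 abc]; rewrite ler01/= /mu_density/=.
move: (pi ^+ 2 : R)%R p0 {k0} => p p0.
rewrite (_ : (p / 4 * _ = (((b + c) * (a + c)) * (a + b))^-1)%R); last first.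
  by field; rewrite !gt_eqF//=; lra.
by rewrite invf_ge1 ?mulr_gt0 ?addr_gt0// !mulr_ile1 ?mulr_ge0//; lra.
Qed.

(** The area is [1/2]; this cruder bound follows from the total mass of [mu] without another
    integral. *)
Lemma vol_Delta_le : vol Delta <= (pi ^+ 2 / 4)%R%:E.
Proof.
by rewrite (le_trans (vol_le_mu (@measurable_Delta R) (@subset_refl _ _)))// mu_Delta mule1.
Qed.

Lemma density_integral_vol0 G A : hom_density G -> measurable A -> A `<=` Delta ->
  vol A = 0 -> density_integral G A = 0.
Proof.
move=> hG mA AD A0; have [mG _ _] := hG.
have mpA : measurable (plane_point @^-1` A).
  by rewrite -[X in measurable X]setTI; exact: measurable_plane_point.
have E (K : pt -> R) : density_integral K A =
    \int[leb \x leb]_(z in plane_point @^-1` A) (K (plane_point z))%:E.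
  by rewrite [RHS]integral_mkcond; apply: eq_integral => z _; rewrite !patchE.
rewrite E null_set_integral//.
- apply/measurable_EFinP; apply: measurable_funTS.
  exact: (measurableT_comp mG (@measurable_plane_point R)).
- by move: A0; rewrite /vol E integral_cst// mul1e.
Qed.

Lemma mu_vol0 A : measurable A -> A `<=` Delta -> vol A = 0 -> mu A = 0.
Proof.
move=> mA AD A0; rewrite muE (setIidr AD).
by apply: density_integral_vol0 => //; exact: hom_mu_density.
Qed.

(** A branch is onto and nonsingular. The pulled back density is bounded below on [Delta] by its
    value at [ones], which dominates every point of [Delta], so a null pullback forces zero area. *)
Lemma mu_branch_null i A : measurable A -> A `<=` Delta ->
  mu (branch i `&` f @^-1` A) = 0 -> mu A = 0.
Proof.
move=> mA AD; rewrite -[X in mu X]/(cyl [:: i] A) mu_cyl//.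
set G := mu_density \o _; have hG : hom_density G.
  by apply: hom_density_cone_word; exact: hom_mu_density.
move=> /eqP; rewrite mule_eq0 eqe (gt_eqF (word_det_gt0 _))/= => /eqP I0.
apply: mu_vol0 => //; apply/eqP; rewrite eq_le vol_ge0 andbT.
pose m := G ones; have m0 : (0 < m)%R.
  rewrite /m -[G ones]/(mu_density (cone_map i ones)).
  have := cone_map_cone i cone_ones.
  case: (cone_map i ones) => -[a b] c [/= a0 b0 c0].
  by rewrite /mu_density/= divr_gt0// !mulr_gt0 ?pi_gt0 ?addr_gt0.
suff : m%:E * vol A <= 0 by rewrite pmule_rle0.
rewrite -density_integral_cst//; last exact: ltW.
rewrite -I0; apply: le_density_integral => //; first by have [] := hG.
move=> x /AD Dx; rewrite ltW//=; apply: mu_density_anti.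
  by apply: cone_word_cone; have [] := (DeltaE x).1 Dx.
apply: (@cone_word_vle [:: i]).
by case: x Dx => -[a b] c [a0 b0 c0 abc]; split => /=; lra.
Qed.

(** At least the proportion [vol A / (16 * pi ^+ 2)] of such a cylinder is sent into [A]. The
    constant is [8 * 8 * (pi ^+ 2 / 4)]: distortion from below, distortion from above, and the bound
    on [vol Delta]. *)
Lemma mu_cyl_distortion w A : measurable A -> A `<=` Delta ->
  vol A * mu (cyl (w ++ double_central) Delta) <=
  (16 * pi ^+ 2)%R%:E * mu (cyl (w ++ double_central) A).
Proof.
move=> mA AD; rewrite !mu_cyl//; last exact: measurable_Delta.
set W := w ++ _; set G := mu_density \o _; set D := word_det _.
have hG : hom_density G.
  by apply: hom_density_cone_word; exact: hom_mu_density.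
have [mG G0 _] := hG.
(* The barycentre is the reference point: on [Delta] the density [G] stays between [m / 8] and
   [8 * m]. *)
pose y : pt := (3^-1, 3^-1, 3^-1)%R.
have Dy : Delta y by split; lra.
pose m := G y; have m0 : (0 <= m)%R.
  by apply: G0; have [] := (DeltaE y).1 Dy.
have D0 := word_det_gt0 W.
have lo : (m / 8)%R%:E * vol A <= density_integral G A.
  rewrite -density_integral_cst//; last exact: divr_ge0.
  apply: le_density_integral => //.
  move=> x /AD Dx; apply/andP; split; first exact: divr_ge0.
  rewrite ler_pdivrMr// mulrC.
  exact: mu_density_distortion.
have hi : density_integral G Delta <= (8 * m)%R%:E * vol Delta.
  have m8 : (0 <= 8 * m)%R by exact: mulr_ge0.
  rewrite -density_integral_cst//; last exact: measurable_Delta.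
  apply: le_density_integral => //; first exact: measurable_Delta.
  move=> x Dx; rewrite mu_density_distortion//= andbT.
  by apply: G0; have [] := (DeltaE x).1 Dx.
have {}hi : density_integral G Delta <= (2 * m * pi ^+ 2)%R%:E.
  apply: (le_trans hi); rewrite (_ : (2 * _ * _ = 8 * m * (pi ^+ 2 / 4))%R); last by field.
  by rewrite [leRHS]EFinM lee_wpmul2l ?vol_Delta_le// lee_fin; exact: mulr_ge0.
apply: (@le_trans _ _ (vol A * (D%:E * (2 * m * pi ^+ 2)%R%:E))).
  by rewrite lee_wpmul2l ?vol_ge0// lee_wpmul2l// lee_fin ltW.
apply: (@le_trans _ _ ((16 * pi ^+ 2)%R%:E * (D%:E * ((m / 8)%R%:E * vol A)))); last first.
  apply: lee_wpmul2l; first by rewrite lee_fin mulr_ge0 ?sqr_ge0.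
  by apply: lee_wpmul2l => //; rewrite lee_fin ltW.
rewrite -(EFinM D) [leLHS]muleC !muleA -!EFinM.
by rewrite (_ : D * _ = 16 * pi ^+ 2 * D * (m / 8))%R//; field.
Qed.

End cylinders.

(** * Recurrence to the double central branch *)

Section recurrence.
Context {R : realType}.
Local Notation pt := (R * R * R)%type.
Local Notation mu := (@mu R).
Local Notation f := (@f_R R).
Local Open Scope ereal_scope.
Implicit Types (x y z : pt) (i : 'I_4) (w u v : seq 'I_4) (A B E : set pt).

Lemma measurable_iter n : measurable_fun setT (iter n f).
Proof.
elim: n => [|n IH]; first exact: measurable_id.
exact: (measurableT_comp (@measurable_f_R R) IH).
Qed.

Lemma measurable_iter_preimage n A : measurable A -> measurable (iter n f @^-1` A).
Proof. by move=> mA; rewrite -[X in measurable X]setTI; exact: measurable_iter. Qed.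

Lemma mu_iter_preimage n A : measurable A -> mu (iter n f @^-1` A) = mu A.
Proof.
move=> mA; elim: n => // n IH; rewrite -IH.
have [_ pres] := @mu_preserving R.
rewrite -[RHS](pres _ (measurable_iter_preimage n mA)); congr mu.
by apply/seteqP; split => x; rewrite /preimage/= -iterS iterSr.
Qed.

Lemma mu_null_bigcup (F : nat -> set pt) : (forall n, measurable (F n)) ->
  (forall n, mu (F n) = 0) -> mu (\bigcup_n F n) = 0.
Proof.
move=> mF F0; apply/negligibleP; first exact: bigcupT_measurable.
by apply: negligible_bigcup => n; exact: ((negligibleP mu (mF n)).2 (F0 n)).
Qed.

Lemma mu_null_setU A B : measurable A -> measurable B ->
  mu A = 0 -> mu B = 0 -> mu (A `|` B) = 0.
Proof.
move=> mA mB A0 B0; apply/negligibleP; first exact: measurableU.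
by apply: negligibleU; [exact: ((negligibleP mu mA).2 A0)|exact: ((negligibleP mu mB).2 B0)].
Qed.

Definition avoid E : set pt := [set x | forall n, ~ E (iter n f x)].

Lemma avoidE E : avoid E = \bigcap_n (iter n f @^-1` (~` E)).
Proof. by apply/seteqP; split => x H n; [move=> _|]; exact: H. Qed.

Lemma measurable_avoid E : measurable E -> measurable (avoid E).
Proof.
move=> mE; rewrite avoidE; apply: bigcapT_measurable => n.
by apply: measurable_iter_preimage; exact: measurableC.
Qed.

(* [avoid E] is contained in its preimage, which has the same finite measure. *)
Lemma mu_entrance E : measurable E -> mu (E `&` f @^-1` avoid E) = 0.
Proof.
move=> mE; have mB := measurable_avoid mE; set B := avoid E in mB *.
have mfB := measurable_preimage mB; have [_ pres] := @mu_preserving R.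
have BfB : B `<=` f @^-1` B by move=> x Bx n; rewrite -iterSr; exact: Bx.
have -> : E `&` f @^-1` B = f @^-1` B `\` B.
  apply/seteqP; split => [x [Ex fBx]|x [fBx nBx]].
    by split => // Bx; exact: (Bx 0%N).
  split => //; apply: contrapT => nEx; apply: nBx => -[//|n].
  by rewrite iterSr; exact: fBx.
rewrite measureD//; last by rewrite -ge0_fin_numE// mu_fin.
by rewrite (setIidr BfB) [X in X - _]pres// subee// mu_fin.
Qed.

(** By [mu_entrance] almost no point of the branch enters the avoiding set, and [mu_branch_null]
    carries this over to that set itself. *)
Lemma mu_avoid_branch i : mu (avoid (branch i)) = 0.
Proof.
have mD := @measurable_Delta R; have mb := @measurable_branch R i.
have mB := measurable_avoid mb.
rewrite -mu_DeltaI; apply: (@mu_branch_null _ i); [exact: measurableI|by move=> x []|].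
apply: mu_null_subset (mu_entrance mb).
- by apply: measurableI => //; apply: measurable_preimage; exact: measurableI.
- by apply: measurableI => //; exact: measurable_preimage.
- by move=> x [? [_ ?]].
Qed.

(** If a point of branch [i] avoids the double branch, its preimage in branch [i] enters the
    avoiding set from the double branch; such points are null. An orbit avoiding the double branch
    either never visits branch [i] or passes through this null set. *)
Lemma mu_avoid_double i : mu (avoid (cyl [:: i; i] setT)) = 0.
Proof.
set E := cyl _ _; set B := avoid E; have mb := @measurable_branch R i.
have mE : measurable E by apply: measurable_cyl; exact: measurableT.
have mB : measurable B := measurable_avoid mE.
have bB0 : mu (branch i `&` B) = 0.
  apply: (@mu_branch_null _ i); [exact: measurableI|by move=> x [/branch_Delta]|].
  apply: mu_null_subset (mu_entrance mE).
  - by apply: measurableI => //; apply: measurable_preimage; exact: measurableI.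
  - by apply: measurableI => //; exact: measurable_preimage.
  - by move=> x [bx [bfx Bfx]]; split.
pose F n := iter n f @^-1` (branch i `&` B).
have mF n : measurable (F n) by apply: measurable_iter_preimage; exact: measurableI.
apply: (@mu_null_subset _ _ (avoid (branch i) `|` \bigcup_n F n)) => //.
- apply: measurableU; first exact: measurable_avoid.
  exact: bigcupT_measurable.
- move=> x Bx; have [ax|] := pselect (avoid (branch i) x); first by left.
  move=> /existsNP[n /contrapT bn]; right; exists n => //; split => //.
  by move=> m; rewrite -iterD; exact: Bx.
- apply: mu_null_setU.
  + exact: measurable_avoid.
  + exact: bigcupT_measurable.
  + exact: mu_avoid_branch.
  + apply: mu_null_bigcup => // n.
    by rewrite mu_iter_preimage//; exact: measurableI.
Qed.

Definition typical : set pt := [set x | (forall n, Delta (iter n f x)) /\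
  forall n, exists2 m, (n <= m)%N & cyl double_central setT (iter m f x)].

(** A measurable null superset takes the place of a measurability statement on [typical]. It
    collects the points some iterate of which leaves [Delta] or avoids the double central branch
    forever. *)
Lemma mu_not_typical : exists N, [/\ measurable N, mu N = 0 & ~` typical `<=` N].
Proof.
have mD := @measurable_Delta R.
set E := cyl double_central setT : set pt.
have mE : measurable E by apply: measurable_cyl; exact: measurableT.
pose F n := iter n f @^-1` (~` Delta); pose H n := iter n f @^-1` (avoid E).
have mF n : measurable (F n) by apply: measurable_iter_preimage; exact: measurableC.
have mH n : measurable (H n) by apply: measurable_iter_preimage; exact: measurable_avoid.
exists (\bigcup_n F n `|` \bigcup_n H n); split.
- by apply: measurableU; exact: bigcupT_measurable.
- apply: mu_null_setU; [exact: bigcupT_measurable|exact: bigcupT_measurable| |].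
    apply: mu_null_bigcup => // n; rewrite mu_iter_preimage ?mu_notDelta//.
    exact: measurableC.
  apply: mu_null_bigcup => // n; rewrite mu_iter_preimage ?mu_avoid_double//.
  exact: measurable_avoid.
- move=> x /not_andP[/existsNP[n nD]|/existsNP[n nE]]; first by left; exists n.
  right; exists n => // m Em; apply: nE; exists (m + n)%N; first exact: leq_addl.
  by rewrite iterD.
Qed.

Lemma inv_branch_f_R i x : branch i x -> inv_branch i (f x) = x.
Proof.
move=> bx; rewrite (f_R_branch bx); have := branch_Delta bx.
rewrite /inv_branch /scale /csum /cone_map; clear bx.
case: i => -[|[|[|[|//]]]] ? /=; case: x => -[a b] c [a0 b0 c0 abc];
  (have E : (a = 1 - b - c)%R by lra); subst a; rewrite /=; congr (_, _, _)%R; field;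
  (try (apply/andP; split)); apply: lt0r_neq0; lra.
Qed.

Lemma inv_branch_scale i t x : (t != 0)%R -> inv_branch i (scale t x) = inv_branch i x.
Proof.
move=> t0; rewrite /inv_branch -[cone_map i (scale t x)]/(cone_word [:: i] (scale t x)).
rewrite cone_word_scale csum_scale /= /scale /=.
by congr (_, _, _)%R; rewrite invfM mulrACA mulVf// mul1r.
Qed.

Lemma cyl_image w x : cyl w Delta x -> let y := iter (size w) f x in
  Delta y /\ x = scale (csum (cone_word w y))^-1 (cone_word w y).
Proof.
elim: w x => [|i w IH] x /=.
  move=> Dx; split => //; have [_ ->] := (DeltaE x).1 Dx; rewrite invr1 /scale !mul1r.
  by case: x Dx => -[].
move=> [bx /IH]; rewrite -iterSr /=; move: (f (iter (size w) f x)) => y [Dy xE].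
split => //; rewrite -{1}(inv_branch_f_R bx) xE inv_branch_scale// invr_eq0.
have [cy _] := (DeltaE y).1 Dy.
by apply: lt0r_neq0; apply: csum_gt0; exact: cone_word_cone.
Qed.

Lemma itinerary n A x : (forall k, Delta (iter k f x)) -> A (iter n f x) ->
  exists2 w, size w = n & cyl w A x.
Proof.
elim: n x => [|n IH] x Dx Ax; first by exists [::].
have [i bi] := branchP (Dx 0%N).
have [w sw cw] : exists2 w, size w = n & cyl w A (f x).
  by apply: IH => [k|]; rewrite -iterSr.
by exists (i :: w) => //=; rewrite sw.
Qed.

Lemma typical_iter n x : typical x -> typical (iter n f x).
Proof.
move=> [Dx Ex]; split=> [k|k]; first by rewrite -iterD.
have [m nm Em] := Ex (k + n)%N.
exists (m - n)%N; first by rewrite leq_subRL ?(leq_trans _ nm) ?leq_addl// addnC.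
by rewrite -iterD subnK// (leq_trans _ nm)// leq_addl.
Qed.

Lemma typical_cyl n x : typical x ->
  exists2 w, (n <= size w)%N & cyl (w ++ double_central) Delta x.
Proof.
move=> [Dx Ex]; have [m nm Em] := Ex n.
have [|w sw cw] := @itinerary m (cyl double_central Delta) x Dx.
  by apply/cylP; split => //; rewrite -iterD.
by exists w; rewrite ?sw// cyl_cat.
Qed.

(** * Shrinking of cylinders, measured by a linear functional *)

Section shrinking.
Variables p q r : R.
Hypotheses (p01 : (0 <= p <= 1)%R) (q01 : (0 <= q <= 1)%R) (r01 : (0 <= r <= 1)%R).

Definition functional x : R := (p * x.1.1 + q * x.1.2 + r * x.2)%R.

(** The inequalities [a <= functional <= b] on the cylinder of [w], cleared of the denominator
    [csum] so that they behave linearly under concatenation. *)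
Definition cyl_bounds w (a b : R) : Prop := forall y, cone y ->
  (a * csum (cone_word w y) <= functional (cone_word w y) <= b * csum (cone_word w y))%R.

Lemma cyl_bounds_nil : cyl_bounds [::] 0 1.
Proof.
case=> -[a b] c [/= a0 b0 c0]; rewrite /functional /csum/=.
case/andP: p01 => ? ?; case/andP: q01 => ? ?; case/andP: r01 => ? ?.
rewrite mul0r mul1r; apply/andP; split; first by rewrite !addr_ge0// mulr_ge0// ltW.
by rewrite !lerD// ger_pMl.
Qed.

Lemma cyl_bounds_cat w v a b : cyl_bounds w a b -> cyl_bounds (w ++ v) a b.
Proof. by move=> H y cy; rewrite cone_word_cat; apply: H; exact: cone_word_cone. Qed.

(* Appending [double_central] maps a triangle into its homothetic image of ratio 1/2 about
   a point of the triangle. *)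
Lemma cyl_bounds_double w a b : cyl_bounds w a b ->
  exists a' b', cyl_bounds (w ++ double_central) a' b' /\ (b' - a' = (b - a) / 2)%R.
Proof.
move=> H; have [ga gb] := andP (H ones cone_ones).
set e := cone_word w ones in ga gb.
have e0 : (0 < csum e)%R by apply: csum_gt0; apply: cone_word_cone; exact: cone_ones.
pose g := (functional e / csum e)%R.
have gE : functional e = (g * csum e)%R by rewrite /g divfK// gt_eqF.
have {}ga : (a <= g)%R by rewrite ler_pdivlMr.
have {}gb : (g <= b)%R by rewrite ler_pdivrMr.
exists ((a + g) / 2)%R, ((b + g) / 2)%R; split; last by field.
move=> y cy; rewrite cone_word_cat cone_double_central cone_word_vadd cone_word_scale -/e.
have /andP[ya yb] := H y cy; set z := cone_word w y in ya yb *.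
have s0 := csum_gt0 cy.
(* Since [y <= csum y * ones] coordinatewise, the new point is a convex combination in which the
   centre, of value [g], has weight at least [1/2]. *)
have zs : (csum z <= csum y * csum e)%R.
  rewrite -csum_scale -cone_word_scale.
  have [] : vle z (cone_word w (scale (csum y) ones)).
    apply: cone_word_vle; case: y cy {s0 ya yb z} => -[? ?] ? [/= ? ? ?].
    by rewrite /vle /csum/=; split; lra.
  by rewrite /csum => *; rewrite !lerD.
have -> : csum (vadd z (scale (csum y) e)) = (csum z + csum y * csum e)%R.
  by rewrite /csum /=; ring.
have -> : functional (vadd z (scale (csum y) e)) = (functional z + csum y * csum e * g)%R.
  rewrite -mulrA [(csum e * g)%R]mulrC -gE /functional /=; ring.
move: (csum y * csum e)%R zs => S zs.
by apply/andP; split; nra.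
Qed.

Lemma cyl_bounds_point w a b x : cyl_bounds w a b -> cyl w Delta x ->
  (a <= functional x <= b)%R.
Proof.
move=> H /cyl_image[Dy xE]; have [cy _] := (DeltaE _).1 Dy.
have := H _ cy; have z0 := csum_gt0 (cone_word_cone w cy).
move: xE z0; move: (cone_word w _) => z -> z0.
have -> : functional (scale (csum z)^-1 z) = (functional z / csum z)%R.
  by rewrite /functional /=; ring.
by rewrite ler_pdivlMr// ler_pdivrMr.
Qed.

(** Each stage restarts at the iterate of [x] reached after [w], again typical, and waits for the
    next [double_central], which halves the width. *)
Lemma typical_shrink k x : typical x -> exists w a b,
  [/\ cyl w Delta x, cyl_bounds w a b & (b - a = (2^-1) ^+ k)%R].
Proof.
move=> tx; elim: k => [|k [w [a [b [cx Hw ab]]]]].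
  exists [::], 0%R, 1%R; split; [exact: (tx.1 0%N)|exact: cyl_bounds_nil|].
  by rewrite subr0.
have [v _ cv] := typical_cyl 0 (typical_iter (size w) tx).
have [a' [b' [Hv ab']]] := cyl_bounds_double (cyl_bounds_cat v Hw).
exists ((w ++ v) ++ double_central), a', b'; split => //.
  by rewrite -catA cyl_cat; apply/cylP; split => //; have [] := (cylP _ _ _).1 cx.
by rewrite ab' ab exprS mulrC.
Qed.

(** A cylinder around [x] narrower than the gap [functional x - c] cannot leave the half-space. *)
Lemma functional_cyl x c : typical x -> (c < functional x)%R ->
  exists2 w, cyl w Delta x & cyl w Delta `<=` [set y | (c < functional y)%R].
Proof.
move=> tx cx.
have [k kx] : exists k, ((2^-1) ^+ k < functional x - c)%R.
  exists (Num.truncn (functional x - c)^-1).+1; rewrite -subr_gt0 in cx.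
  rewrite exprVn invf_plt ?posrE ?exprn_gt0//.
  rewrite (lt_le_trans (truncnS_gt _))// -natrX ler_nat; exact/ltnW/ltn_expl.
have [w [a [b [cw Hw ab]]]] := typical_shrink k tx.
exists w => // y cy /=.
have /andP[ay _] := cyl_bounds_point Hw cy.
have /andP[_ xb] := cyl_bounds_point Hw cw.
lra.
Qed.

End shrinking.

End recurrence.

(** * Approximation by cylinder sets *)

Section generation.
Context {R : realType}.
Local Notation pt := (R * R * R)%type.

Lemma sigma_algebra_preimage (T T' : Type) (g : T -> T') (C : set (set T)) :
  sigma_algebra setT C -> sigma_algebra setT [set X | C (g @^-1` X)].
Proof.
move=> [C0 CC CU]; split => /=; first by rewrite preimage_set0.
- by move=> X /CC; rewrite !setTD preimage_setC.
- by move=> F CF; rewrite preimage_bigcup; exact: CU.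
Qed.

Lemma measurable_ind_ray (C : set (set R)) : sigma_algebra setT C ->
  (forall c, C `]c, +oo[%classic) -> forall X, measurable X -> C X.
Proof.
move=> sC CX X mX.
have : (@RGenOInfty.G R).-sigma.-measurable X by rewrite -RGenOInfty.measurableE.
by apply: smallest_sub => // _ [c ->].
Qed.

(** The product sigma-algebra is generated by preimages under the coordinates, and [C] is pushed
    forward along each of them to the Borel sets of the line. *)
Lemma measurable_ind_triple (C : set (set pt)) : sigma_algebra setT C ->
  (forall c, C [set x | c < x.1.1]) -> (forall c, C [set x | c < x.1.2]) ->
  (forall c, C [set x | c < x.2]) -> forall X, measurable X -> C X.
Proof.
move=> sC C0 C1 C2.
have ray (g : pt -> R) : (forall c, C [set x | c < g x]) ->
    forall Y, measurable Y -> C (g @^-1` Y).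
  move=> Cg; apply: (measurable_ind_ray (sigma_algebra_preimage g sC)) => c /=.
  rewrite (_ : _ @^-1` _ = [set x | c < g x])//.
  by apply/seteqP; split => x /=; rewrite in_itv/= andbT.
apply: smallest_sub => // _ [[Y mY <-]|[Y mY <-]]; rewrite setTI; last exact: ray.
move: Y mY; apply: smallest_sub; first exact: (@sigma_algebra_preimage _ _ fst).
by move=> _ [[Z mZ <-]|[Z mZ <-]] /=; rewrite setTI -comp_preimage; exact: ray.
Qed.

End generation.

(** * Sets determined by finitely many letters *)

Section determined.
Context {R : realType}.
Local Notation pt := (R * R * R)%type.
Local Notation mu := (@mu R).
Local Notation f := (@f_R R).
Local Open Scope ereal_scope.
Implicit Types (x y z : pt) (i : 'I_4) (w u v : seq 'I_4) (A B U V : set pt).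

(** An equivalence for every letter, so that iterates outside [Delta], which lie in no branch, are
    compared as well. *)
Definition same_itinerary n x y := forall k, (k < n)%N -> forall i,
  branch i (iter k f x) <-> branch i (iter k f y).

Definition determined n V := forall x y, same_itinerary n x y -> V x -> V y.

Lemma same_itinerary_sym n x y : same_itinerary n x y -> same_itinerary n y x.
Proof. by move=> H k kn i; split => /(H k kn i). Qed.

Lemma determined_leq m n V : (m <= n)%N -> determined m V -> determined n V.
Proof.
by move=> mn H x y xy; apply: H => k km; apply: xy; exact: leq_trans mn.
Qed.

Lemma determinedC n V : determined n V -> determined n (~` V).
Proof. by move=> H x y xy Vx Vy; apply: Vx; exact: H (same_itinerary_sym xy) Vy. Qed.

Lemma determinedU n U V : determined n U -> determined n V -> determined n (U `|` V).
Proof. by move=> HU HV x y xy [/(HU _ _ xy)|/(HV _ _ xy)]; [left|right]. Qed.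

(** The additional letter detects that the iterate reached after [w] lies in [Delta], the union of
    the branches. *)
Lemma determined_cyl w : determined (size w).+1 (cyl w Delta).
Proof.
elim: w => [|i w IH] x y xy /=.
  by move=> /branchP[i /(xy 0%N isT i)]; exact: branch_Delta.
move=> [bx cx]; split; first exact/(xy 0%N isT i).
by apply: IH cx => k kn j; rewrite -!iterSr; exact: xy.
Qed.

Lemma cyl_same_itinerary w x y : cyl w setT x -> cyl w setT y ->
  same_itinerary (size w) x y.
Proof.
elim: w x y => //= i w IH x y [bx cx] [by_ cy] [_ j|k kn j].
  by split => bj; [rewrite (branch_inj bj bx)|rewrite (branch_inj bj by_)].
by rewrite !iterSr; exact: IH.
Qed.

Lemma countable_words : countable [set: seq 'I_4].
Proof. exact: countableP. Qed.

(** Continuity from above of a finite measure, applied to the decreasing remainders. *)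
Lemma mu_exhaust (W : nat -> set pt) B (e : R) : (forall n, measurable (W n)) ->
  measurable B -> {homo W : m n / (m <= n)%N >-> m `<=` n} ->
  mu (B `\` \bigcup_n W n) = 0 -> (0 < e)%R ->
  exists n, mu (B `\` W n) <= e%:E.
Proof.
move=> mW mB homoW B0 e0; apply: contrapT => /forallNP He.
have mF n : measurable (B `\` W n) by exact: measurableD.
have : mu \o (fun n => B `\` W n) @ \oo --> mu (\bigcap_n (B `\` W n)).
  apply: nonincreasing_cvg_mu => //.
  - by rewrite -ge0_fin_numE// mu_fin.
  - exact: bigcapT_measurable.
  - by move=> m n mn; apply/subsetPset => x [Bx nWx]; split => // /(homoW _ _ mn).
rewrite (_ : \bigcap_n _ = B `\` \bigcup_n W n); last first.
  apply/seteqP; split => x H; first split.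
  - by have [] := H 0%N I.
  - by move=> [n _ Wn]; have [_] := H n I; apply.
  - by move=> n _; split; [exact: H.1|move=> Wn; apply: H.2; exists n].
rewrite B0 => F0; have : e%:E <= 0.
  apply: (@cvge_ge _ _ _ _ _ _ _ _ F0); apply: nearW => n /=.
  by rewrite ltW// ltNge; apply/negP; exact: He.
by rewrite lee_fin leNgt e0.
Qed.

Definition approximable B := measurable B /\ forall e : R, (0 < e)%R ->
  exists n V, [/\ measurable V, determined n V & mu (B `+` V) <= e%:E].

Lemma measurable_setY A B : measurable A -> measurable B -> measurable (A `+` B).
Proof. by move=> mA mB; apply: measurableU; exact: measurableD. Qed.

Lemma approximable0 : approximable set0.
Proof.
split => // e e0; exists 0%N, set0; split => //.
by rewrite setYK measure0 lee_fin ltW.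
Qed.

Lemma approximableC B : approximable B -> approximable (~` B).
Proof.
move=> [mB aB]; split=> [|e e0]; first exact: measurableC.
have [n [V [mV dV BV]]] := aB e e0.
exists n, (~` V); split; [exact: measurableC|exact: determinedC|].
by rewrite /setY !setDE !setCK setUC setIC [X in _ `|` X]setIC.
Qed.

(** Approximation from inside is enough: the symmetric difference of [B] and [V] is covered by [B]
    minus [F n] and that of [F n] and [V], at most [e / 2] each. *)
Lemma approximable_near B (F : nat -> set pt) : measurable B ->
  (forall n, approximable (F n)) -> (forall n, F n `<=` B) ->
  (forall e : R, (0 < e)%R -> exists n, mu (B `\` F n) <= e%:E) -> approximable B.
Proof.
move=> mB aF FB near; split=> // e e0.
have e2 : (0 < e / 2)%R by rewrite divr_gt0.
have [n Bn] := near _ e2; have [mF /(_ _ e2)[m [V [mV dV FV]]]] := aF n.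
exists m, V; split => //.
have mBF : measurable (B `\` F n) by exact: measurableD.
have mFV := measurable_setY mF mV.
rewrite (splitr e) EFinD (le_trans _ (leeD Bn FV))//.
rewrite (le_trans _ (measureU2 _ mBF mFV))// le_measure ?inE//.
- exact: measurable_setY.
- exact: measurableU.
- move=> x [[Bx nVx]|[Vx nBx]]; last by right; right; split => // /FB.
  by have [Fx|nFx] := pselect (F n x); [right; left|left].
Qed.

Lemma approximableU A B : approximable A -> approximable B -> approximable (A `|` B).
Proof.
move=> [mA aA] [mB aB]; split=> [|e e0]; first exact: measurableU.
have e2 : (0 < e / 2)%R by rewrite divr_gt0.
have [m [U [mU dU AU]]] := aA _ e2; have [n [V [mV dV BV]]] := aB _ e2.
exists (maxn m n), (U `|` V); split; first exact: measurableU.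
  by apply: determinedU; [apply: determined_leq dU|apply: determined_leq dV];
    rewrite ?leq_maxl ?leq_maxr.
have mAU := measurable_setY mA mU; have mBV := measurable_setY mB mV.
rewrite (splitr e) EFinD (le_trans _ (leeD AU BV))//.
rewrite (le_trans _ (measureU2 _ mAU mBV))// le_measure ?inE//.
- by apply: measurable_setY; exact: measurableU.
- exact: measurableU.
- by move=> x [[[Ax|Bx] /not_orP[nU nV]]|[[Ux|Vx] /not_orP[nA nB]]];
    [left; left|right; left|left; right|right; right].
Qed.

(** Sets determined by finitely many letters form an algebra, which handles finite unions; a
    countable union is exhausted by its finite partial unions. *)
Lemma sigma_algebra_approximable : sigma_algebra setT approximable.
Proof.
split; first exact: approximable0.
- by move=> A aA; rewrite setTD; exact: approximableC.
- move=> F aF; pose W n := \big[setU/set0]_(k < n) F k.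
  have aW n : approximable (W n).
    by rewrite /W; elim/big_ind : _ => //; [exact: approximable0|exact: approximableU].
  have mU : measurable (\bigcup_k F k) by apply: bigcupT_measurable => k; case: (aF k).
  apply: (approximable_near mU aW) => [n x|e e0].
    by rewrite /W -bigcup_mkord => -[k _ Fk]; exists k.
  apply: mu_exhaust => //.
  + by move=> n; case: (aW n).
  + move=> m n mn x; rewrite /W -!bigcup_mkord => -[k /= km Fk].
    by exists k => //=; exact: leq_trans mn.
  + rewrite (_ : _ `\` _ = set0) ?measure0//; apply/seteqP; split => // x [[k _ Fk]].
    by case; exists k.+1 => //; rewrite /W -bigcup_mkord; exists k => /=.
Qed.

Lemma approximable_halfspace (g : pt -> R) c : measurable [set x | (c < g x)%R] ->
  (forall x, typical x -> (c < g x)%R ->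
     exists2 w, cyl w Delta x & cyl w Delta `<=` [set y | (c < g y)%R]) ->
  approximable [set x | (c < g x)%R].
Proof.
set B := [set x | _] => mB HB.
(* The cylinders of words shorter than [n] contained in the half-space; their union over all [n]
   contains its typical points. *)
pose W n : set pt := \bigcup_(w in [set w | (size w < n)%N /\ cyl w Delta `<=` B]) cyl w Delta.
have mD := @measurable_Delta R.
have mW n : measurable (W n).
  rewrite /W bigcup_mkcond; apply: countable_bigcupT_measurable countable_words _ => w.
  by case: ifP => // _; exact: measurable_cyl.
have WB n : W n `<=` B by move=> x [w [_ wB]] /wB.
apply: (approximable_near mB _ WB) => [n|e e0].
  split=> // e e0; exists n, (W n); split => //.
    move=> x y xy [w [wn wB] cx]; exists w => //.
    exact: (determined_leq wn (@determined_cyl w)) xy cx.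
  by rewrite setYK measure0 lee_fin ltW.
apply: mu_exhaust => //.
  move=> m n mn x [w [wm wB] cx]; exists w => //; split => //.
  exact: leq_trans mn.
have [N [mN N0 tN]] := @mu_not_typical R.
apply: mu_null_subset N0 => //.
  by apply: measurableD => //; exact: bigcupT_measurable.
move=> x [Bx nW]; apply: tN => tx; apply: nW.
by have [w cw wB] := HB x tx Bx; exists (size w).+1 => //; exists w.
Qed.

Lemma measurable_approximable B : measurable B -> approximable B.
Proof.
have mh (g : pt -> R) c : measurable_fun setT g -> measurable [set x | (c < g x)%R].
  move=> mg; apply: measurable_bool_set; exact: measurable_fun_ltr.
have z01 : (0 <= (0 : R) <= 1)%R by rewrite lexx ler01.
have o01 : (0 <= (1 : R) <= 1)%R by rewrite lexx ler01.
apply: measurable_ind_triple => [|c|c|c]; first exact: sigma_algebra_approximable.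
- apply: approximable_halfspace => [|x tx cx]; first exact: (mh _ _ (@measurable_fst_fst R)).
  have := functional_cyl o01 z01 z01 tx; rewrite /functional.
  rewrite !mul0r !mul1r !addr0 => /(_ c cx) [w cw H]; exists w => // y /H /=.
  by rewrite !mul0r !mul1r !addr0.
- apply: approximable_halfspace => [|x tx cx]; first exact: (mh _ _ (@measurable_fst_snd R)).
  have := functional_cyl z01 o01 z01 tx; rewrite /functional.
  rewrite !mul0r !mul1r !addr0 add0r => /(_ c cx) [w cw H]; exists w => // y /H /=.
  by rewrite !mul0r !mul1r !addr0 add0r.
- apply: approximable_halfspace => [|x tx cx]; first exact: (mh _ _ measurable_snd).
  have := functional_cyl z01 z01 o01 tx; rewrite /functional.
  rewrite !mul0r !mul1r !add0r => /(_ c cx) [w cw H]; exists w => // y /H /=.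
  by rewrite !mul0r !mul1r !add0r.
Qed.

End determined.

(** * Ergodicity *)

Section ergodicity.
Context {R : realType}.
Local Notation pt := (R * R * R)%type.
Local Notation mu := (@mu R).
Local Notation f := (@f_R R).
Local Open Scope ereal_scope.
Implicit Types (x y z : pt) (i : 'I_4) (w u v : seq 'I_4) (A B U V : set pt).

Lemma cyl_prefix u v A x : cyl u setT x -> cyl v A x -> (size u <= size v)%N ->
  take (size u) v = u.
Proof.
elim: u v x => [|i u IH] [|j v] x //=.
by move=> [bi cu] [bj cv] uv; rewrite (branch_inj bi bj) (IH v (f x)).
Qed.

Lemma cyl_take k w x : (k <= size w)%N -> cyl w Delta x -> cyl (take k w) Delta x.
Proof.
elim: k w x => [|k IH] [|i w] x //= kw; first by move=> [/branch_Delta].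
by move=> [bi cw]; split => //; exact: IH.
Qed.

(** * Disjoint decomposition into cylinders of minimal words *)

Section minimal_words.
Variable U : set pt.

(** The suffix is what makes [mu_cyl_distortion] applicable to the cylinder. *)
Definition inner_word w := (exists u, w = u ++ double_central) /\ cyl w Delta `<=` U.

Definition minimal_word w := inner_word w /\
  forall k, (k < size w)%N -> ~ inner_word (take k w).

Lemma minimal_word_cover w x : inner_word w -> cyl w Delta x ->
  exists2 v, minimal_word v & cyl v Delta x.
Proof.
move=> Iw cw; pose P k := `[< inner_word (take k w) >].
have exP : exists k, P k by exists (size w); apply/asboolP; rewrite take_size.
case: (ex_minnP exP) => k /asboolP Ik mink.
have kw : (k <= size w)%N by apply: mink; apply/asboolP; rewrite take_size.
exists (take k w); last exact: cyl_take.
split => // j; rewrite size_takel// => jk; rewrite take_takel ?(ltnW jk)//.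
by move=> Ij; have /mink : P j; [exact/asboolP|rewrite leqNgt jk].
Qed.

(** Of two words whose cylinders share a point, the shorter is a prefix of the longer; minimality
    excludes a proper prefix. *)
Lemma minimal_word_inj v w x : minimal_word v -> minimal_word w ->
  cyl v Delta x -> cyl w Delta x -> v = w.
Proof.
wlog vw : v w / (size v <= size w)%N => [H Mv Mw cv cw|[Iv _] [_ Mw] cv cw].
  have [vw|/ltnW wv] := leqP (size v) (size w); first exact: H.
  by apply/esym; exact: H.
have [cv' _] := (cylP _ _ _).1 cv; have E := cyl_prefix cv' cw vw.
move: vw; rewrite leq_eqVlt => /orP[/eqP vw|/Mw]; last by rewrite E.
by rewrite -E vw take_size.
Qed.

(** Words are enumerated by [pickle] to obtain a sequence; the other indices contribute the empty
    set. *)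
Definition minimal_cyl (n : nat) : set pt :=
  if pickle_inv n is Some w then (if `[< minimal_word w >] then cyl w Delta else set0)
  else set0.

Lemma measurable_minimal_cyl n : measurable (minimal_cyl n).
Proof.
rewrite /minimal_cyl; case: pickle_inv => // w; case: ifP => // _.
by apply: measurable_cyl; exact: measurable_Delta.
Qed.

Lemma trivIset_minimal_cyl : trivIset setT minimal_cyl.
Proof.
apply/trivIsetP => m n _ _ /eqP mn; apply/seteqP; split => // x []; rewrite /minimal_cyl.
have := pickle_invK (T := seq 'I_4) m; case: (pickle_inv m) => //= v vm.
case: asboolP => // Mv; have := pickle_invK (T := seq 'I_4) n.
case: (pickle_inv n) => //= w wn; case: asboolP => // Mw cv cw.
by apply: mn; rewrite -vm -wn (minimal_word_inj Mv Mw cv cw).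
Qed.

Lemma bigcup_minimal_cyl : \bigcup_n minimal_cyl n `<=` U.
Proof.
move=> x [n _]; rewrite /minimal_cyl; case: (pickle_inv n) => // w.
by case: asboolP => // -[[_ wU] _] /wU.
Qed.

Lemma inner_word_bigcup w x : inner_word w -> cyl w Delta x ->
  (\bigcup_n minimal_cyl n) x.
Proof.
move=> Iw cw; have [v Mv cv] := minimal_word_cover Iw cw.
by exists (pickle v) => //; rewrite /minimal_cyl pickleK_inv; case: asboolP.
Qed.

End minimal_words.

(** * Invariant sets are trivial *)

Section invariant_set.
Variable A : set pt.
Hypothesis mA : measurable A.
Hypothesis invA : mu ((f @^-1` A) `+` A) = 0.

Lemma mu_iter_invariant n : mu ((iter n f @^-1` A) `+` A) = 0.
Proof.
have mf := measurable_preimage mA.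
elim: n => [|n IH]; first by rewrite /= setYK measure0.
have mS : measurable ((f @^-1` A) `+` A) by exact: measurable_setY.
have mn k : measurable (iter k f @^-1` A) by exact: measurable_iter_preimage.
apply: (@mu_null_subset _ _ ((iter n f @^-1` ((f @^-1` A) `+` A)) `|`
    ((iter n f @^-1` A) `+` A))).
- exact: measurable_setY.
- by apply: measurableU; [exact: measurable_iter_preimage|exact: measurable_setY].
- move=> x; have [An|nAn] := pselect (A (iter n f x)).
    by move=> [[ASn nA]|[Ax nASn]]; [right; left|left; right].
  by move=> [[ASn nA]|[Ax nASn]]; [left; left|right; right].
- apply: mu_null_setU => //; [exact: measurable_iter_preimage|exact: measurable_setY|].
  by rewrite mu_iter_preimage.
Qed.

(** Up to a null set, [A] is its own preimage under the iterate of order [size w], so its part in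
    the cylinder consists of the points sent into [A]. *)
Lemma mu_setI_cyl w : mu (A `&` cyl w Delta) = mu (cyl w (Delta `&` A)).
Proof.
have mD := @measurable_Delta R.
have mC : measurable (cyl w (@Delta R)) by exact: measurable_cyl.
have mn : measurable (iter (size w) f @^-1` A) by exact: measurable_iter_preimage.
have -> : cyl w (Delta `&` A) = (iter (size w) f @^-1` A) `&` cyl w Delta.
  apply/seteqP; split => [x /cylP[cx [Dx Ax]]|x [Ax /cylP[cx Dx]]].
    by split => //; apply/cylP.
  by apply/cylP.
have N := mu_iter_invariant (size w); have mN := measurable_setY mn mA.
have le B B' : measurable B -> measurable B' ->
    B `<=` B' `|` ((iter (size w) f @^-1` A) `+` A) -> mu B <= mu B'.
  move=> mB mB' BB'; rewrite -[leRHS]adde0 -N (le_trans _ (measureU2 _ mB' mN))//.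
  by rewrite le_measure ?inE//; exact: measurableU.
apply/eqP; rewrite eq_le; apply/andP; split; apply: le; do ?exact: measurableI.
- move=> x [Ax cx]; have [An|nAn] := pselect (A (iter (size w) f x)); first by left.
  by right; right.
- move=> x [An cx]; have [Ax|nAx] := pselect (A x); first by left.
  by right; left.
Qed.

(** The minimal cylinders inside [U] are disjoint and cover almost all of it; [mu_cyl_distortion] is
    summed over them. *)
Lemma mu_inner_cover U : measurable U ->
  (forall x, typical x -> U x -> exists2 w, inner_word U w & cyl w Delta x) ->
  vol (Delta `&` A) * mu U <= (16 * pi ^+ 2)%R%:E * mu (A `&` U).
Proof.
move=> mU HU; have mD := @measurable_Delta R.
have mDA : measurable (Delta `&` A) by exact: measurableI.
have DAD : Delta `&` A `<=` Delta by move=> x [].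
have mG := measurable_minimal_cyl U; have tG := @trivIset_minimal_cyl U.
have mUG : measurable (\bigcup_n minimal_cyl U n) by exact: bigcupT_measurable.
have UG : mu U <= mu (\bigcup_n minimal_cyl U n).
  have [N [mN N0 tN]] := @mu_not_typical R.
  rewrite -[leRHS]adde0 -N0 (le_trans _ (measureU2 _ mUG mN))// le_measure ?inE//.
    exact: measurableU.
  move=> x Ux; have [tx|/tN] := pselect (typical x); last by right.
  by left; have [w Iw cw] := HU x tx Ux; exact: inner_word_bigcup Iw cw.
have vfin : vol (Delta `&` A) \is a fin_num.
  rewrite ge0_fin_numE ?vol_ge0// (le_lt_trans (vol_le_mu mDA DAD))//.
  by rewrite -(fineK (mu_fin mDA)) -EFinM ltry.
rewrite (le_trans (lee_wpmul2l (vol_ge0 _) UG))//.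
apply: (@le_trans _ _ ((16 * pi ^+ 2)%R%:E * mu (A `&` \bigcup_n minimal_cyl U n))); last first.
  apply: lee_wpmul2l; first by rewrite lee_fin mulr_ge0// sqr_ge0.
  rewrite le_measure ?inE//; [exact: measurableI|exact: measurableI|].
  by apply: setIS; exact: bigcup_minimal_cyl.
rewrite setI_bigcupr !measure_semi_bigcup//.
- rewrite -(fineK vfin) -!nneseriesZl//; apply: lee_nneseries => [n _ _|n _].
    by rewrite mule_ge0// lee_fin fine_ge0// vol_ge0.
  rewrite (fineK vfin) /minimal_cyl; case: (pickle_inv n) => [w|]; last first.
    by rewrite setI0 measure0 !mule0.
  case: asboolP => [[[[u ->] _] _]|_]; last by rewrite setI0 measure0 !mule0.
  by have := mu_cyl_distortion u mDA DAD; rewrite -mu_setI_cyl.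
- by move=> n; exact: measurableI.
- exact: trivIset_setIl.
- by rewrite -setI_bigcupr; exact: measurableI.
Qed.

(** All points of a cylinder whose word has length at least [n] share their first [n] letters, hence
    lie in [V] together. *)
Lemma determined_inner_word n V x : determined n V -> typical x -> V x ->
  exists2 w, inner_word V w & cyl w Delta x.
Proof.
move=> dV tx Vx; have [w nw cw] := typical_cyl n tx.
exists (w ++ double_central) => //; split; first by exists w.
have cT y : cyl (w ++ double_central) Delta y -> cyl (w ++ double_central) setT y.
  by move=> /cylP[].
move=> y cy; apply: (dV x) => // k kn.
apply: (cyl_same_itinerary (cT _ cw) (cT _ cy)).
by rewrite size_cat (leq_trans kn)// (leq_trans nw)// leq_addr.
Qed.

(** If [A] has positive area, it fills a fixed proportion of every set determined by finitely many
    letters. A set [V] of this kind close to the complement of [A] meets [A] in small measure, so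
    [V], and with it the complement, is small. *)
Lemma invariant_trivial : mu A = 0 \/ mu A = 1.
Proof.
have mD := @measurable_Delta R.
have mDA : measurable (Delta `&` A) by exact: measurableI.
have DAD : Delta `&` A `<=` Delta by move=> x [].
have [v0|vn0] := eqVneq (vol (Delta `&` A)) 0.
  by left; rewrite -mu_DeltaI; exact: mu_vol0.
right; set v := vol _ in vn0.
have vfin : v \is a fin_num.
  rewrite ge0_fin_numE ?vol_ge0// (le_lt_trans (vol_le_mu mDA DAD))//.
  by rewrite -(fineK (mu_fin mDA)) -EFinM ltry.
have v_gt0 : 0 < v by rewrite lt_neqAle eq_sym vn0 vol_ge0.
have mC : measurable (~` A) by exact: measurableC.
have [_ aC] := measurable_approximable mC.
set K : R := (16 * pi ^+ 2)%R.
have K0 : (0 <= K)%R by rewrite mulr_ge0// sqr_ge0.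
(* The term [K * e] bounds [v * mu V] through [mu_inner_cover]; the term [fine v * e] comes from the
   part of the complement outside [V]. *)
have bound (e : R) : (0 < e)%R -> v * mu (~` A) <= ((K + fine v) * e)%:E.
  move=> e0; have [n [V [mV dV CV]]] := aC e e0.
  have mS := measurable_setY mC mV.
  have := mu_inner_cover mV (fun x => determined_inner_word dV) => HV.
  have AV : mu (A `&` V) <= e%:E.
    rewrite (le_trans _ CV)// le_measure ?inE//; first exact: measurableI.
    by move=> x [Ax Vx]; right; split.
  have CA : mu (~` A) <= mu V + e%:E.
    rewrite (le_trans _ (leeD (lexx _) CV))// (le_trans _ (measureU2 _ mV mS))//.
    rewrite le_measure ?inE//; first exact: measurableU.
    by move=> x nA; have [Vx|nV] := pselect (V x); [left|right; left].
  rewrite (le_trans (lee_wpmul2l (ltW v_gt0) CA))//.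
  rewrite muleDr//; last by rewrite fin_num_adde_defl.
  rewrite mulrDl EFinD leeD//; last by rewrite EFinM fineK.
  by rewrite (le_trans HV)// [leRHS]EFinM lee_wpmul2l.
have C0 : mu (~` A) = 0.
  apply/eqP; rewrite eq_le measure_ge0 andbT.
  rewrite -(pmule_rle0 _ v_gt0); apply/lee_addgt0Pr => e e0; rewrite add0e.
  have k0 : (0 < K + fine v)%R by rewrite ltr_wpDl// fine_gt0// v_gt0 ltey_eq vfin.
  have := bound (e / (K + fine v))%R (divr_gt0 e0 k0).
  by rewrite mulrC divfK// gt_eqF.
have : mu setT = mu (~` A) + mu A.
  by rewrite [LHS](measureDI mu measurableT mA) setTI setTD.
by rewrite mu_setT C0 add0e.
Qed.

End invariant_set.

End ergodicity.

Theorem theorem1p3 (R : realType) :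
  [/\ @mu R Delta = 1%E,
      measure_preserving (@mu R) f_R &
      ergodic (@mu R) f_R].
Proof.
split; [exact: mu_Delta|exact: mu_preserving|].
by move=> A mA invA; exact: invariant_trivial.
Qed.
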